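(* Let $q\ge 4$ and $p=2q-2$. If $n>n_0(p)$ is sufficiently large, then $$(p-q)n-\binom{p-q+1}{2}+1\le g(n,K_p|\langle K_q\rangle)\le \mathrm{Ar}\bigl(n,\{C_{2p-2q+1}\cup K_2,\ C_{2p-2q+2}\}\bigr)\le (p-q)n.$$
   Context: $C_k$ is the cycle on $k$ vertices, and $C_k\cup K_2$ is the vertex-disjoint union of $C_k$ and a single edge. For a family $\mathcal{H}$ of graphs, the anti-Ramsey number $\mathrm{Ar}(n,\mathcal{H})$ is the smallest integer $k$ such that every edge coloring of $K_n$ with at least $k$ colors contains a rainbow copy (all edges of distinct colors) of at least one member of $\mathcal{H}$. For a graph $F$, $\langle F\rangle$ is the family of all graphs containing $F$ as a subgraph (not necessarily induced). In an edge coloring of $K_n$ (not necessarily proper), for a copy $G'\subseteq K_n$ of a graph $G$, a color class of $G'$ is the graph formed by all edges of $G'$ having a given color that occurs in $G'$. For a family $\mathcal{F}$ of graphs with $K_2\notin\mathcal{F}$ and $n\ge|G|$, $g(n,G|\mathcal{F})$ is the largest integer $m$ for which there exists an edge coloring of $K_n$ using exactly $m$ colors such that every copy of $G$ contains a color class which is a member of $\mathcal{F}$; if no such coloring exists, then $g(n,G|\mathcal{F}):=0$. *)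

(* Defs.v *)
From HB Require Import structures.
From mathcomp Require Import all_boot all_order all_algebra.
From mathcomp Require Import boolp.

Set Implicit Arguments.
Unset Strict Implicit.
Unset Printing Implicit Defensive.

Record sgraph := SGraph {
  vertex :> finType;
  adj : rel vertex;
  adj_sym : symmetric adj;
  adj_irr : irreflexive adj }.

Definition edges (G : sgraph) : {set {set G}} :=
  [set [set e.1; e.2] | e : G * G & adj e.1 e.2].

Definition isomorphic (G H : sgraph) : Prop :=
  exists2 f : G -> H, bijective f & forall u v, adj (f u) (f v) = adj u v.

(* [F] is a not necessarily induced subgraph of [G], up to isomorphism. *)
Definition subgraph (F G : sgraph) : Prop :=
  exists2 f : F -> G, injective f & forall u v, adj u v -> adj (f u) (f v).

Definition graph_family := sgraph -> Prop.

(* Families are read up to isomorphism. *)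
Definition member (F : graph_family) (G : sgraph) : Prop :=
  exists2 H, F H & isomorphic H G.

Definition family2 (G1 G2 : sgraph) : graph_family :=
  fun G => G = G1 \/ G = G2.

(* The family usually written <F>. *)
Definition containing (F : sgraph) : graph_family := fun G => subgraph F G.

Section Complete.
Variable n : nat.
Definition complete_adj : rel 'I_n := fun u v => u != v.
Fact complete_sym : symmetric complete_adj.
Proof. by move=> u v; rewrite /complete_adj eq_sym. Qed.
Fact complete_irr : irreflexive complete_adj.
Proof. by move=> u; rewrite /complete_adj eqxx. Qed.
Definition complete : sgraph := SGraph complete_sym complete_irr.
End Complete.

(* [ordS] is the successor modulo [k]; this is C_k for [k >= 3]. *)
Section Cycle.
Variable k : nat.
Definition cycle_adj : rel 'I_k :=
  fun u v => (u != v) && ((v == ordS u) || (u == ordS v)).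
Fact cycle_sym : symmetric cycle_adj.
Proof. by move=> u v; rewrite /cycle_adj eq_sym orbC. Qed.
Fact cycle_irr : irreflexive cycle_adj.
Proof. by move=> u; rewrite /cycle_adj eqxx. Qed.
Definition cycle_graph : sgraph := SGraph cycle_sym cycle_irr.
End Cycle.

Section DisjointUnion.
Variables G H : sgraph.
Definition disjoint_union_adj : rel (G + H) := fun x y =>
  match x, y with
  | inl u, inl v => adj u v
  | inr u, inr v => adj u v
  | _, _ => false
  end.
Fact disjoint_union_sym : symmetric disjoint_union_adj.
Proof. by case=> [u|u] [v|v] //=; rewrite adj_sym. Qed.
Fact disjoint_union_irr : irreflexive disjoint_union_adj.
Proof. by case=> u /=; rewrite adj_irr. Qed.
Definition disjoint_union : sgraph :=
  SGraph disjoint_union_sym disjoint_union_irr.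
End DisjointUnion.

(* The graph formed by a set [E] of edges: its vertices are the endpoints of
   the edges in [E], so it has no isolated vertices. *)
Section EdgeGraph.
Variables (T : finType) (E : {set {set T}}).
Definition edge_graph_adj : rel {x : T | x \in cover E} :=
  fun u v => (u != v) && ([set val u; val v] \in E).
Fact edge_graph_sym : symmetric edge_graph_adj.
Proof. by move=> u v; rewrite /edge_graph_adj eq_sym setUC. Qed.
Fact edge_graph_irr : irreflexive edge_graph_adj.
Proof. by move=> u; rewrite /edge_graph_adj eqxx. Qed.
Definition edge_graph : sgraph := SGraph edge_graph_sym edge_graph_irr.
End EdgeGraph.

(* Only the values on [edges (complete n)] matter. *)
Definition coloring (n : nat) := {set 'I_n} -> nat.

Definition num_colors n (c : coloring n) : nat :=
  size (undup [seq c e | e in edges (complete n)]).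

(* A copy of [G] in K_n is given by an injective [f : G -> 'I_n]; these are its
   edges. *)
Definition copy_edges n (G : sgraph) (f : G -> 'I_n) : {set {set 'I_n}} :=
  [set f @: e | e : {set G} in edges G].

Definition has_rainbow_copy n (c : coloring n) (G : sgraph) : Prop :=
  exists2 f : G -> 'I_n, injective f & {in copy_edges f &, injective c}.

Definition color_class n (c : coloring n) (G : sgraph) (f : G -> 'I_n) (a : nat)
  : sgraph := edge_graph [set e in copy_edges f | c e == a].

Definition has_class_in n (F : graph_family) (c : coloring n) (G : sgraph)
    (f : G -> 'I_n) : Prop :=
  exists2 a, a \in [seq c e | e in copy_edges f] & member F (color_class c f a).

Lemma num_colors_le n (c : coloring n) :
  num_colors c <= #|edges (complete n)|.
Proof. by rewrite (leq_trans (size_undup _)) // size_map cardE. Qed.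

Definition forces_rainbow n (H : graph_family) (k : nat) : Prop :=
  forall c : coloring n, k <= num_colors c ->
  exists2 G, H G & has_rainbow_copy c G.

Lemma forces_rainbow_exists n (H : graph_family) :
  exists k, `[< forces_rainbow n H k >].
Proof.
exists (#|edges (complete n)|).+1; apply/asboolP => c.
by rewrite ltnNge num_colors_le.
Qed.

Definition Ar n (H : graph_family) : nat := ex_minn (forces_rainbow_exists n H).

Definition g_admissible n (G : sgraph) (F : graph_family) (m : nat) : Prop :=
  exists2 c : coloring n, num_colors c = m &
    forall f : G -> 'I_n, injective f -> has_class_in F c f.

(* The range of [m] is no restriction, by [num_colors_le]; the maximum over an
   empty set of [m] is 0. *)
Definition g n (G : sgraph) (F : graph_family) : nat :=
  \max_(m < (#|edges (complete n)|).+1 | `[< g_admissible n G F m >]) m.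

Lemma g_ge n G F m : g_admissible n G F m -> m <= g n G F.
Proof.
move=> adm; have ltm : m < (#|edges (complete n)|).+1.
  by case: adm => c <- _; rewrite ltnS num_colors_le.
by apply: (@leq_bigmax_cond _ _ _ (Ordinal ltm)); apply/asboolP.
Qed.

Lemma g_attained n G F :
  (exists m, g_admissible n G F m) -> g_admissible n G F (g n G F).
Proof.
case=> m adm; have ltm : m < (#|edges (complete n)|).+1.
  by case: adm => c <- _; rewrite ltnS num_colors_le.
have [|i /asboolP adm_i gE] := @eq_bigmax_cond _
  [pred i : 'I_(#|edges (complete n)|).+1 | `[< g_admissible n G F i >]]
  (fun i => i : nat).
  by apply/card_gt0P; exists (Ordinal ltm); apply/asboolP.
by rewrite /g gE.
Qed.

(* Main.v *)
Require Import Defs.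
From mathcomp Require Import all_boot all_order all_algebra.
From mathcomp Require Import boolp zify.
Import Order.TTheory GRing.Theory Num.Theory.
Set Implicit Arguments.
Unset Strict Implicit.
Unset Printing Implicit Defensive.

(** Put [d = p - q = q - 2 >= 2]: then [p = 2 d + 2], and the two cycles have
    lengths [2 d + 1] and [2 d + 2].

    The lower bound on [g] comes from the colouring in which the edges that
    meet a fixed set of [d] vertices all get different colours and the other
    edges share one further colour: of any [p = q + d] vertices at least [q]
    lie off the set ([num_colors_hub], [hub_coloring_class]).

    For [Ar <= d n], let no member of the family have a rainbow copy.

    - If there is no rainbow [C_(2d+1)] at all, there are at most [d (n - 1)]
      colours ([card_colors_no_rainbow_cycle]).  In a smallest counterexample,
      deleting a nonempty proper set [H] of vertices destroys more than [d |H|]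
      colours; in particular every vertex has more than [d] private colours,
      which occur only on edges at that vertex.  Choose one edge for every
      private colour.  The ends of a path of chosen edges may be joined by an
      arbitrary edge of [K_n]: its colour differs from those on the path,
      unless it is private to one of the two ends ([closing_color]).  For
      paths whose two end edges carry colours private to inner vertices, nothing
      is left to block a rainbow cycle.  This rules out cycles of more than
      [2 d] chosen edges ([no_gcycle]), and rotations of a longest path then
      produce a set [H] of at most [2 d] vertices that no chosen edge leaves
      ([closed_set]).  Of the more than
      [d |H|] colours destroyed with [H], at most [d (|H| - 1)] occur inside
      [H], so at least three occur only between [H] and its complement, and
      none of them is a star.  Two disjoint edges in two of these colours, a
      path in [H] and a path outside [H] close up to a rainbow [C_(2d+2)]
      ([closed_contradiction]).
    - If there is a rainbow [C_(2d+1)], edges disjoint from it only repeat its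
      colours.  A vertex off the cycle cannot see two consecutive vertices of
      it in two new colours, so it brings at most [d] new colours, and the
      total is at most [d n].  Equality would force the clique on the cycle to
      be rainbow; any two of its vertices are then consecutive on some rainbow
      cycle, and a vertex off it brings at most one new colour
      ([card_colors_rainbow_cycle]).

    For [g <= Ar], suppose that a colouring with [g] colours has a rainbow
    member of the family.  Each [K_p] contains a monochromatic [K_q], whereas
    [q = d + 2] vertices of a cycle of length [2 d + 2] span two of its edges:
    so the member is a cycle [C] of length [2 d + 1] with a disjoint edge [uv].
    For every vertex [w] off [C], the clique found in [C + w] consists of [w]
    and [d + 1] vertices of [C], in the colour of an edge of [C].  The cliques
    in the [K_p]'s that contain [u], [v] and all but one vertex of [C] show
    that [u] has at most one new colour towards [C] ([clique_of_edge]), and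
    counting gives fewer colours than the lower bound
    ([card_colors_mono_clique]). *)

(** * Sequences and maxima *)

Lemma exists_max (Q : nat -> Prop) (b : nat) :
    (exists n, Q n) -> (forall n, Q n -> n <= b) ->
  exists2 n, Q n & forall m, Q m -> m <= n.
Proof.
move=> exQ ubQ.
have exP : exists n, `[< Q n >] by case: exQ => n Qn; exists n; apply/asboolP.
have ubP n : `[< Q n >] -> n <= b by move/asboolP/ubQ.
case: (ex_maxnP exP ubP) => n /asboolP Qn max_n.
by exists n => // m Qm; apply/max_n/asboolP.
Qed.

(** The pigeonhole principle behind every rotation below: for a path [s] and two
    vertices [v], [w] with many neighbours on it, it yields consecutive [x], [y]
    on [s] such that [v] is adjacent to [x] and [w] to [y]. *)
Lemma consecutive_pair (T : Type) (a b : pred T) (s : seq T) :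
    (size s).+1 < count a s + count b s ->
  exists s1 x y s2, [/\ s = s1 ++ x :: y :: s2, a x & b y].
Proof.
case: s => [|x s] //= lt_s.
have {lt_s} : (size s).+1 < a x + count a s + count b s.
  by move: lt_s; case: (b x) => /=; lia.
elim: s x => [|y s IHs] x /=; first by case: (a x).
have [/andP[ax bY] _ | nab lt_s] := boolP (a x && b y).
  by exists [::], x, y, s.
have [|s1 [x' [y' [s2 [-> ax bY]]]]] := IHs y.
  by move: nab lt_s; case: (a x); case: (b y) => //=; lia.
by exists (x :: s1), x', y', s2.
Qed.

Lemma mem_split (T : eqType) (y : T) (s : seq T) :
  y \in s -> exists s1 s2, s = s1 ++ y :: s2.
Proof. by case/splitPr=> s1 s2; exists s1, s2. Qed.

(** * Rainbow cycles as sequences of vertices *)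

Lemma uniq_map_inj (T1 T2 : eqType) (f : T1 -> T2) (s : seq T1) :
  uniq (map f s) -> {in s &, injective f}.
Proof.
elim: s => //= z s IHs /andP[fz Us] x y; rewrite !inE.
case/predU1P=> [-> | sx] /predU1P[-> | sy] // fxy.
- by case/mapP: fz; exists y.
- by case/mapP: fz; exists x.
- exact: IHs.
Qed.

Section RainbowCycles.

Variables (V : finType) (C : finType) (col : V -> V -> C).
Hypothesis colC : forall x y, col x y = col y x.

Definition cycle_colors (s : seq V) : seq C :=
  if s is x :: p then pairmap col x (rcons p x) else [::].

Definition rainbow_cycle (s : seq V) : bool := uniq s && uniq (cycle_colors s).

Lemma pairmap_rcons (x : V) p z :
  pairmap col x (rcons p z) = rcons (pairmap col x p) (col (last x p) z).
Proof. by rewrite -cats1 pairmap_cat /= cats1. Qed.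

Lemma map_next (x : V) p : uniq (x :: p) ->
  [seq next (x :: p) y | y <- x :: p] = rcons p x.
Proof.
move=> Us; apply: (@eq_from_nth _ x); first by rewrite size_map size_rcons.
move=> i; rewrite size_map => lti.
rewrite (nth_map x) // next_nth mem_nth // index_uniq //= nth_rcons.
move: lti => /=; rewrite ltnS leq_eqVlt => /orP[/eqP-> | lti].
  by rewrite ltnn eqxx nth_default.
by rewrite lti; apply: set_nth_default.
Qed.

Lemma cycle_colorsE s : uniq s ->
  cycle_colors s = [seq col x (next s x) | x <- s].
Proof.
case: s => // x p Us.
have pairmapE (y : V) q :
    pairmap col y q = [seq col z.1 z.2 | z <- zip (y :: q) q].
  by elim: q y => [|z q IHq] y //=; rewrite IHq.
have zip_rcons (y : V) q z : zip (y :: rcons q z) (rcons q z) = zip (y :: q) (rcons q z).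
  by elim: q y => [|t q IHq] y //=; rewrite IHq.
rewrite /cycle_colors pairmapE zip_rcons -(map_next Us).
by rewrite -[X in zip X]map_id zip_map -map_comp.
Qed.

Lemma rainbow_cycleP s :
  reflect (uniq s /\ {in s &, injective (fun x => col x (next s x))})
          (rainbow_cycle s).
Proof.
rewrite /rainbow_cycle; apply: (iffP andP) => -[Us].
  rewrite cycle_colorsE // => Uc; split=> // x y sx sy.
  exact: (uniq_map_inj Uc).
by move=> inj; rewrite cycle_colorsE // map_inj_in_uniq.
Qed.

End RainbowCycles.

(** * The graph of private colours *)

(** [o x y] is meant to hold for the edge [xy] chosen to represent its colour,
    when this colour is private to [x]; [o_private] says that it is, and
    [gedge_col] that chosen edges have different colours. *)
Section PrivateGraph.

Variables (V : finType) (C : finType) (col : V -> V -> C) (d : nat).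
Hypothesis colC : forall x y, col x y = col y x.
Hypothesis d_ge2 : 1 < d.
Hypothesis no_rainbow : forall s : seq V,
  size s = (2 * d).+1 \/ size s = (2 * d).+2 -> ~~ rainbow_cycle col s.

Variable o : rel V.
Hypothesis o_neq : forall x y, o x y -> x != y.
Hypothesis o_private : forall x y z t : V,
  o x y -> z != t -> col z t = col x y -> (x == z) || (x == t).

Definition gedge : rel V := fun x y => o x y || o y x.

Hypothesis gedge_col : forall x y z t, gedge x y -> gedge z t ->
  col x y = col z t -> (x = z /\ y = t) \/ (x = t /\ y = z).
Hypothesis o_deg : forall x, d < #|o x|.

Lemma gedge_sym : symmetric gedge.
Proof. by move=> x y; rewrite /gedge orbC. Qed.

Lemma gedge_neq x y : gedge x y -> x != y.
Proof. by case/orP=> /o_neq //; rewrite eq_sym. Qed.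

Lemma o_gedge : subrel o gedge.
Proof. by move=> x y oxy; rewrite /gedge oxy. Qed.

Lemma mem_pairmap (e : rel V) (x : V) (p : seq V) (a : C) :
    path e x p -> a \in pairmap col x p ->
  exists y z, [/\ a = col y z, e y z, y \in belast x p & z \in p].
Proof.
elim: p x => //= y p IHp x /andP[exy ep].
rewrite inE => /predU1P[-> | /(IHp _ ep)[u [v [-> euv yu pv]]]].
  by exists x, y; rewrite !inE !eqxx.
by exists u, v; split=> //; rewrite inE ?yu ?pv orbT.
Qed.

Lemma uniq_path_colors (x : V) (p : seq V) :
  uniq (x :: p) -> path gedge x p -> uniq (pairmap col x p).
Proof.
elim: p x => //= y p IHp x /andP[xp Up] /andP[gxy gp].
rewrite IHp // andbT; apply/negP=> /(mem_pairmap gp)[u [v [Euv guv yu pv]]].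
move: xp; rewrite inE negb_or => /andP[nxy xp].
have [[xu _] | [xv _]] := gedge_col gxy guv Euv; last by rewrite xv pv in xp.
by move/mem_belast: yu; rewrite -xu inE (negPf nxy) (negPf xp).
Qed.

(** The closing edge [xt] touches no vertex of the path but its ends, whereas the
    colour of every inner edge, and of the last one, is private to another
    vertex.  So only the colour of the first edge can block the rainbow cycle. *)
Lemma closing_color (x h t : V) (q : seq V) :
    uniq (x :: h :: rcons q t) -> path gedge x (h :: rcons q t) ->
    o (last h q) t -> (size q).+2 = 2 * d \/ (size q).+2 = (2 * d).+1 ->
  col x t = col x h.
Proof.
move=> Us gp ot sz; apply/eqP/negPn/negP => nxt.
have /negP[] : ~~ rainbow_cycle col (x :: h :: rcons q t).
  apply: no_rainbow; rewrite /= size_rcons; lia.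
rewrite /rainbow_cycle Us /= (pairmap_rcons col h) last_rcons.
have := uniq_path_colors Us gp => /= /andP[Ux Uq].
rewrite mem_rcons inE negb_or Ux andbT rcons_uniq Uq andbT [col t x]colC eq_sym nxt /=.
have nhq : x \notin h :: q /\ t \notin h :: q.
  move: Us; rewrite -rcons_cons cons_uniq rcons_uniq mem_rcons inE negb_or.
  by case/andP=> /andP[_ ->] /andP[->].
case: nhq => xq tq.
have xt : x != t.
  by apply: contraTneq Us => ->; rewrite cons_uniq -rcons_cons mem_rcons mem_head.
rewrite (pairmap_rcons col h) mem_rcons inE negb_or.
move: gp => /= /andP[gxh]; rewrite rcons_path => /andP[gp gt].
have out y : y \in h :: q -> (y == x) || (y == t) = false.
  by move=> qy; apply/negP=> /orP[]/eqP E; [rewrite -E qy in xq | rewrite -E qy in tq].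
apply/andP; split.
  apply/negP=> /eqP E; have := o_private ot xt.
  by rewrite E out ?mem_last // => /(_ erefl).
apply/negP=> /(mem_pairmap gp)[u [v [E guv qu qv]]].
have hu : u \in h :: q by apply: mem_belast.
have hv : v \in h :: q by rewrite inE qv orbT.
case/orP: guv => [ouv | ovu].
  by have := o_private ouv xt; rewrite E out // => /(_ erefl).
by have := o_private ovu xt; rewrite E [col v u]colC out // => /(_ erefl).
Qed.

(** When the first edge also carries a colour private to its inner end, nothing
    blocks the closing edge. *)
Lemma no_sink_path (x t : V) (m : seq V) :
    uniq (x :: rcons m t) -> path gedge x (rcons m t) -> m != [::] ->
    o (head x m) x -> o (last x m) t ->
    (size m).+1 = 2 * d \/ size m = 2 * d -> False.
Proof.
case: m => // h q Us gp _ /= ohx ot sz.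
have E := closing_color Us gp ot.
have {}E : col x t = col x h by apply: E; move: sz => /=; lia.
have xt : x != t.
  by apply: contraTneq Us => ->; rewrite cons_uniq mem_rcons mem_head.
case/orP: (o_private ohx xt (etrans E (colC _ _))) => /eqP Eh.
  by move: Us; rewrite /= Eh mem_head.
by move: Us; rewrite /= Eh mem_rcons mem_head andbF.
Qed.

(** The union of the two branches is a path in which both end edges carry
    colours private to their inner ends. *)
Lemma no_spider (u : V) (p1 p2 : seq V) :
    path o u p1 -> path o u p2 -> uniq (u :: p1 ++ p2) ->
    p1 != [::] -> p2 != [::] -> 
    size (p1 ++ p2) = 2 * d \/ size (p1 ++ p2) = (2 * d).+1 -> False.
Proof.
case/lastP: p1 => // p1 a; case/lastP: p2 => // p2 b op1 op2 Us _ _ sz.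
move: op1 op2; rewrite !rcons_path => /andP[op1 oa] /andP[op2 ob].
have go := sub_path o_gedge.
have Em : a :: rcons (rev (u :: p1) ++ p2) b = rev (u :: rcons p1 a) ++ rcons p2 b.
  by rewrite -[u :: rcons p1 a]rcons_cons rev_rcons rcons_cat.
apply: (@no_sink_path a b (rev (u :: p1) ++ p2)).
- rewrite Em (perm_uniq (_ : perm_eq _ ((u :: rcons p1 a) ++ rcons p2 b))) //.
  by rewrite perm_cat2r perm_rev.
- rewrite rcons_cat cat_path; apply/andP; split.
    have := rev_path gedge u (rcons p1 a); rewrite last_rcons belast_rcons => ->.
    rewrite (eq_path (e' := gedge)); last by move=> x y; rewrite gedge_sym.
    by rewrite rcons_path (go _ _ op1) o_gedge.
  rewrite rev_cons last_rcons rcons_path (go _ _ op2) o_gedge //.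
- by rewrite rev_cons -cats1 -catA; case: (rev p1).
- by rewrite (lastI u p1) rev_rcons.
- by rewrite last_cat rev_cons last_rcons.
- move: sz; rewrite !size_cat !size_rcons size_rev /=; lia.
Qed.

(** Another private colour of [x] leads to some [y].  If [y] is off the path, it
    replaces the last vertex as the second branch of a spider at [x]; if it is
    on the path, jumping to [y] splits the path into two branches. *)
Lemma no_dipath (x : V) (p : seq V) :
  uniq (x :: p) -> path o x p -> size p = 2 * d -> False.
Proof.
case: p => [|z p] Us op sz; first by move: sz d_ge2 => /=; lia.
have [y oxy nyz] : exists2 y, o x y & y != z.
  have /card_gt0P[y] : 0 < #|[predD1 o x & z]|.
    by have := cardD1 z (o x); have := o_deg x; case: (z \in o x); lia.
  by rewrite !inE => /andP[nyz oxy]; exists y.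
have [py | pNy] := boolP (y \in z :: p).
  move: py Us op sz; case/splitPr E: _ / => [p1 p2] Us op sz.
  case: p1 E Us op sz => [[Ez]|a p1 _ Us op sz]; first by rewrite Ez eqxx in nyz.
  move: op; rewrite cat_path => /andP[op1 /= /andP[_ op2]].
  apply: (@no_spider x (a :: p1) (y :: p2)) => //; first by rewrite /= oxy.
  by left.
move: op Us pNy sz; rewrite lastI rcons_path => /andP[op _].
move: (belast z p) (last z p) op => q t op Us qNy sz.
have q_gt0 : 0 < size q by move: sz d_ge2; rewrite size_rcons; lia.
apply: (@no_spider x [:: y] q) => //=; rewrite ?oxy //.
- move: Us qNy; rewrite /= mem_rcons !inE !negb_or rcons_uniq mem_rcons !inE.
  rewrite !negb_or (o_neq oxy) /=.
  by case/andP=> /andP[_ ->] /andP[_ ->] /andP[_ ->].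
- by case: (q) q_gt0.
- by left; rewrite -sz size_rcons.
Qed.

(** A cycle of [2 d + 1] or [2 d + 2] chosen edges is a forbidden rainbow cycle.
    Around a longer one, each edge has a colour private to its start or to its
    end.  By [no_sink_path], edges whose colour
    is private to their end reproduce themselves [2 d - 1] and [2 d] steps
    later, hence everywhere, and the whole cycle is directed, against
    [no_dipath]. *)
Section LongCycle.
Variables (x : V) (p : seq V).
Hypothesis Us : uniq (x :: p).
Hypothesis gp : path gedge x (rcons p x).
Let l := (size p).+1.
Let z i := nth x (x :: p) (i %% l).

Let gz i : gedge (z i) (z i.+1).
Proof.
have lt_i : i %% l < l by rewrite ltn_mod.
have := pathP x gp (i %% l); rewrite size_rcons lt_i => /(_ isT).
suff -> : nth x (rcons p x) (i %% l) = z i.+1.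
  by rewrite -rcons_cons nth_rcons /= -/l lt_i.
rewrite /z -addn1 -modnDml addn1 nth_rcons.
have [lti | ge_i] := ltnP (i %% l) (size p); first by rewrite (@modn_small _.+1).
have -> : i %% l = size p by move: lt_i ge_i; rewrite /l; lia.
by rewrite eqxx modnn.
Qed.

Let path_z i k : path gedge (z i) (map z (iota i.+1 k)).
Proof. by elim: k i => //= k IHk i; rewrite gz IHk. Qed.

Let uniq_z i k : k <= l -> uniq (map z (iota i k)).
Proof.
move=> le_kl; rewrite map_inj_in_uniq ?iota_uniq // => a b.
rewrite !mem_iota => /andP[ia ak] /andP[ib bk] /eqP.
rewrite /z nth_uniq ?ltn_mod // => /eqP Em.
wlog le_ab : a b ia ak ib bk Em / a <= b => [wl|].
  by case/orP: (leq_total a b) => ?; [apply: wl | apply/esym/wl].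
have : l %| b - a by rewrite -eqn_mod_dvd // Em.
by case: (posnP (b - a)) => [|ba_gt0 /dvdn_leq]; lia.
Qed.

Let label_jump i k : k.+2 <= l -> k.+1 = 2 * d \/ k = 2 * d ->
  o (z i.+1) (z i) -> ~~ o (z (i + k)) (z (i + k).+1).
Proof.
move=> le_kl Ek oi; apply/negP=> ok.
have Em : rcons (map z (iota i.+1 k)) (z (i + k).+1) = map z (iota i.+1 k.+1).
  by rewrite -addSn -[k.+1]addn1 iotaD map_cat /= cats1.
have k_gt0 : 0 < k by move: d_ge2; lia.
apply: (@no_sink_path (z i) (z (i + k).+1) (map z (iota i.+1 k))).
- by rewrite Em; apply: (uniq_z i le_kl).
- by rewrite Em path_z.
- by case: (k) k_gt0.
- by case: (k) k_gt0.
- case: (k) k_gt0 ok => // k' _.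
  by rewrite -[k'.+1]addn1 iotaD map_cat last_cat /= addnA addSn -addnS addn1.
- by rewrite size_map size_iota.
Qed.

(* Modulo the length [l] of the cycle, [l - 1] steps of [2 d - 1] undo one such
   step, so one more step of [2 d] amounts to a single step forward. *)
Let label_step i : 2 * d + 3 <= l ->
  o (z i.+1) (z i) -> o (z i.+2) (z i.+1).
Proof.
move=> le_l oi.
have step j k : k.+1 = 2 * d \/ k = 2 * d ->
    o (z j.+1) (z j) -> o (z (j + k).+1) (z (j + k)).
  move=> Ek oj; have /orP[ok|//] := gz (j + k).
  by have /negP[] : ~~ o (z (j + k)) (z (j + k).+1) by apply: label_jump; lia.
have steps m : o (z (i + m * (2 * d).-1).+1) (z (i + m * (2 * d).-1)).
  elim: m => [|m IHm]; first by rewrite addn0.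
  by rewrite mulSn addnCA addnA -addnA addnC; apply: step IHm; move: d_ge2; lia.
have := step _ (2 * d) (or_intror erefl) (steps l.-1).
have -> : i + l.-1 * (2 * d).-1 + 2 * d = i.+1 + (2 * d).-1 * l.
  have [c Ec] : exists c, 2 * d = c.+1 by exists (2 * d).-1; move: d_ge2; lia.
  rewrite /l Ec /=; nia.
have periodic j : z (j + (2 * d).-1 * l) = z j by rewrite /z addnC modnMDl.
by rewrite -addSn !periodic.
Qed.

Lemma no_gcycle : 2 * d <= size p -> False.
Proof.
move=> le_d; have [le_l | lt_l] := leqP (2 * d + 3) l.
  have [[i oi] | noL] := pselect (exists i, o (z i.+1) (z i)).
    have oj j : o (z (i + j).+1) (z (i + j)).
      by elim: j => [|j IHj]; rewrite ?addn0 // addnS; apply: label_step.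
    have := rev_path o (z i) (map z (iota i.+1 (2 * d))).
    have -> : path (fun u => o^~ u) (z i) (map z (iota i.+1 (2 * d))).
      suff P k m : path (fun u => o^~ u) (z (i + m)) (map z (iota (i + m).+1 k)).
        by have := P (2 * d) 0; rewrite addn0.
      by elim: k m => //= k IHk m; rewrite oj -addnS IHk.
    move/no_dipath; apply; last by rewrite size_rev size_belast size_map size_iota.
    rewrite -rev_rcons -lastI rev_uniq.
    by apply: (@uniq_z i (2 * d).+1); lia.
  have oj j : o (z j) (z j.+1).
    by have /orP[//|oj] := gz j; case: noL; exists j.
  apply: (@no_dipath (z 0) (map z (iota 1 (2 * d)))).
  - by apply: (@uniq_z 0 (2 * d).+1); lia.
  - suff P k m : path o (z m) (map z (iota m.+1 k)) by apply: P.
    by elim: k m => //= k IHk m; rewrite oj IHk.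
  - by rewrite size_map size_iota.
have /negP[] : ~~ rainbow_cycle col (x :: p).
  by apply: no_rainbow; move: lt_l le_d; rewrite /= /l; lia.
rewrite /rainbow_cycle Us /= pairmap_rcons rcons_uniq.
move: Us gp; rewrite rcons_path => Us' /andP[gp' gx].
rewrite (uniq_path_colors Us' gp') andbT.
case: p Us' gp' gx le_d => [|h [|a q]] /=; [move: d_ge2; lia.. |].
move=> Us2 /andP[gxh gpa] gl _.
have [nxh nxa xq nha hq] : [/\ x != h, x != a, x \notin q, h != a & h \notin q].
  by move: Us2; rewrite !inE !negb_or => /and3P[/and3P[-> -> ->] /andP[-> ->]].
rewrite inE negb_or; apply/andP; split.
  apply/eqP=> /(gedge_col gl gxh) [[E _] | [E _]].
    by have := mem_last a q; rewrite E inE (negPf nxa) (negPf xq).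
  by have := mem_last a q; rewrite E inE (negPf nha) (negPf hq).
have hpa : path gedge h (a :: q) by [].
apply/negP => in_hq; case: (mem_pairmap hpa in_hq) => y [w [E gyw /mem_belast yb wq]].
have [[_ Ex]|[Ex _]] := gedge_col gl gyw E.
  by move: wq; rewrite -Ex !inE (negPf nxa) (negPf xq).
have [[_ Ew]|[_ Ey]] := gedge_col gl gyw E.
  by move: wq; rewrite -Ew !inE (negPf nxa) (negPf xq).
by move: yb; rewrite -Ey !inE (negPf nxh) (negPf nxa) (negPf xq).
Qed.

End LongCycle.

(** A walk that has made fewer than [k] steps cannot have used up the [k]
    out-neighbours off [F] of its last vertex. *)
Lemma greedy_dipath (F : {set V}) (k : nat) (y : V) :
    (forall v, v \notin F -> k <= #|[pred w | o v w & w \notin F]|) ->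
    y \notin F ->
  exists ys, [/\ path o y ys, uniq (y :: ys), all [predC F] (y :: ys)
                & size ys = k].
Proof.
move=> outF yF; suff: forall i, i <= k ->
    exists ys, [/\ path o y ys, uniq (y :: ys), all [predC F] (y :: ys) & size ys = i].
  by apply.
elim=> [_ | i IHi lt_ik]; first by exists [::]; rewrite /= yF.
have [ys [oys Uys Fys sz]] := IHi (ltnW lt_ik).
have last_in : last y ys \in y :: ys by apply: mem_last.
have [w /andP[ow wF] wys] : exists2 w, o (last y ys) w && (w \notin F) & w \notin belast y ys.
  apply/exists_inP; rewrite -negb_forall_in; apply/negP=> /forall_inP all_in.
  have := outF _ (allP Fys _ last_in); rewrite leqNgt => /negP[].
  apply: leq_ltn_trans lt_ik; rewrite -sz -(size_belast y ys).
  apply: leq_trans (card_size _); apply/subset_leq_card/subsetP => w.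
  by rewrite inE => /all_in /=; rewrite ?negbK.
exists (rcons ys w); rewrite rcons_path oys ow size_rcons sz; split=> //.
- rewrite -rcons_cons rcons_uniq Uys andbT lastI mem_rcons inE negb_or wys andbT.
  by rewrite eq_sym o_neq.
- by rewrite -rcons_cons all_rcons Fys /= wF.
Qed.

Lemma deg_count (v : V) (s : seq V) :
  (forall y, gedge v y -> y \in s) -> d < count (gedge v) s.
Proof.
move=> nbrs; apply: leq_trans (o_deg v) _; rewrite -size_filter.
apply: leq_trans (card_size _); apply/subset_leq_card/subsetP => y ovy.
by rewrite mem_filter o_gedge // nbrs // o_gedge.
Qed.

Lemma rotate_path (x v : V) (q1 q2 : seq V) :
    path gedge x (q1 ++ v :: q2) -> gedge x v ->
  path gedge (last x q1) (rev (belast x q1) ++ v :: q2).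
Proof.
rewrite cat_path => /andP[gq1 /= /andP[_ gq2]] gxv.
rewrite cat_path rev_path (eq_path (e' := gedge)); last first.
  by move=> y z; rewrite gedge_sym.
rewrite gq1 /= gq2 andbT; suff -> : last (last x q1) (rev (belast x q1)) = x by [].
by case: (q1) => //= a q; rewrite rev_cons last_rcons.
Qed.

(** Take a longest path whose start [x] has its last neighbour as far along the
    path as possible, and let [S] be the part of the path up to this neighbour;
    [S] spans a cycle, so it has at most [2 d] vertices.  The other vertices at
    which a rotation of [S] can start also have all their neighbours in [S].
    If [S] is the whole path, this applies to all its vertices, and [S] is
    closed.  Otherwise two consecutive neighbours of [x] provide a vertex [v]
    at which two spanning paths of [S] start, with different first edges and
    with the same last vertex; both extend, by a directed path outside [S], to
    paths with [2 d + 2] vertices, and [closing_color] would give their two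
    first edges the same colour. *)
Lemma closed_set (v0 : V) :
  exists H : {set V}, [/\ H != set0, #|H| <= 2 * d
                        & forall x y, gedge x y -> x \in H -> y \in H].
Proof.
have size_lt (x : V) p : uniq (x :: p) -> size p <= #|V|.
  by move/card_uniqP=> /= E; apply: ltnW; rewrite -E max_card.
(* [m] is the length of a longest path, [j] the largest index of a neighbour of
   the start of such a path. *)
pose Q1 m := exists (x : V) (p : seq V),
  [/\ uniq (x :: p), path gedge x p & size p = m].
have [|_ [x [p [/size_lt ? _ <-]]] // | m Q1m max1] := @exists_max Q1 #|V|.
  by exists 0, v0, [::].
have nbr_in (x : V) p y : uniq (x :: p) -> path gedge x p -> size p = m ->
    gedge x y -> y \in p.
  move=> Us gp sz gxy; apply/negPn/negP => yp.
  suff /max1 : Q1 (size p).+1 by rewrite sz ltnn.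
  exists y, (x :: p); split=> //=; last by rewrite gedge_sym gxy.
  by rewrite inE negb_or yp andbT eq_sym (gedge_neq gxy).
pose Q2 j := exists (x : V) (p1 p2 : seq V),
  [/\ uniq (x :: p1 ++ p2), path gedge x (p1 ++ p2), size (p1 ++ p2) = m,
      gedge x (last x p1) & size p1 = j].
have [||j [x [p1 [p2 [Us gp sz gxl sz1]]]] max2] := @exists_max Q2 m.
- have [x [p [Us gp sz]]] := Q1m.
  have [y oxy] : exists y, o x y by apply/card_gt0P/(leq_ltn_trans _ (o_deg x)).
  have := nbr_in _ _ _ Us gp sz (o_gedge oxy).
  move=> /splitPr E; case: E Us gp sz => q1 q2 Us gp sz.
  exists (size (rcons q1 y)), x, (rcons q1 y), q2.
  by rewrite cat_rcons last_rcons o_gedge.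
- by move=> _ [x [p1 [p2 [_ _ <- _ <-]]]]; rewrite size_cat leq_addr.
(* Every path on [x :: p1] that can replace it within the longest path has all
   the neighbours of its start on it. *)
have end_nbrs (e : V) q : perm_eq (e :: q) (x :: p1) -> path gedge e q ->
    p2 = [::] \/ last e q = last x p1 -> forall y, gedge e y -> y \in q.
  move=> eq_q gq Eq y gey.
  have Us' : uniq (e :: q ++ p2).
    by rewrite -cat_cons (perm_uniq (_ : perm_eq _ (x :: p1 ++ p2))) // -cat_cons perm_cat2r.
  have gq' : path gedge e (q ++ p2).
    rewrite cat_path gq /=; case: Eq => -> //.
    by move: gp; rewrite cat_path => /andP[].
  have sz' : size (q ++ p2) = m.
    by move/perm_size: eq_q sz => /= [E]; rewrite !size_cat E.
  have := nbr_in _ _ _ Us' gq' sz' gey; rewrite mem_cat => /orP[// | /splitPr E].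
  case: E Us' gq' sz' => r1 r2 Us' gq' sz'.
  suff /max2 : Q2 (size (q ++ rcons r1 y)).
    move/perm_size: eq_q => /= [E].
    by rewrite size_cat size_rcons E sz1 addnS ltnNge leq_addr.
  exists e, (q ++ rcons r1 y), r2.
  by rewrite -catA cat_rcons last_cat last_rcons.
have [Us1 gp1] : uniq (x :: p1) /\ path gedge x p1.
  move: Us gp; rewrite -cat_cons cat_uniq cat_path.
  by case/andP=> -> _ /andP[-> _].
have lt_j : j < 2 * d.
  rewrite ltnNge -sz1; apply/negP/(no_gcycle Us1).
  by rewrite rcons_path gp1 gedge_sym.
(* When [S] is the whole path, each of its vertices is the start of a longest path
   along the cycle. *)
case: p2 => [|y1 p2] in Us gp sz end_nbrs *.
  exists [set y in x :: p1]; split.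
  - by apply/set0Pn; exists x; rewrite inE mem_head.
  - rewrite (leq_trans _ lt_j) // cardsE; apply: leq_trans (card_size _) _.
    by rewrite /= sz1.
  move=> y z gyz; rewrite !inE => py.
  have [Eyx | nyx] := eqVneq y x.
    rewrite Eyx in gyz; have := end_nbrs x p1 (perm_refl _) gp1 (or_introl erefl) _ gyz.
    by move=> ->; rewrite orbT.
  have {py} /splitPr E : y \in p1 by move: py; rewrite (negPf nyx).
  case: E Us1 gp1 gxl end_nbrs => q1 q2 Us1 gp1 gxl end_nbrs.
  have Ep : perm_eq (y :: q2 ++ x :: q1) (x :: q1 ++ y :: q2).
    by rewrite -[y :: _]cat_cons -[x :: _ ++ _]cat_cons perm_catC.
  have := end_nbrs y (q2 ++ x :: q1) Ep _ (or_introl erefl) _ gyz.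
  rewrite -in_cons -(perm_mem Ep) inE => ->; rewrite ?orbT //.
  move: gp1 gxl; rewrite !cat_path last_cat /= => /andP[-> /andP[_ ->]].
  by rewrite gedge_sym => ->.
exfalso.
pose S := x :: p1.
have sz_S : size S = j.+1 by rewrite /= sz1.
have [gl1 gp2] : gedge (last x p1) y1 /\ path gedge y1 p2.
  by move: gp; rewrite cat_path => /andP[_ /= /andP[]].
have rot_nbrs q1 v q2 : p1 = q1 ++ v :: q2 -> gedge x v ->
    forall y, gedge (last x q1) y -> y \in S.
  move=> E gxv y gly; move: (gp1); rewrite E => /rotate_path/(_ gxv) gr.
  have Ep : perm_eq (last x q1 :: rev (belast x q1) ++ v :: q2) S.
    by rewrite /S E -!cat_cons perm_cat2r -rev_rcons -lastI perm_rev.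
  rewrite -(perm_mem Ep) inE (end_nbrs _ _ Ep gr _ _ gly) ?orbT //.
  by right; rewrite E !last_cat.
have nbrs_x y : gedge x y -> y \in p1.
  exact: end_nbrs (perm_refl _) gp1 (or_intror erefl) y.
(* The vertices of [L] have no neighbour outside [S], so at most [j - d] vertices
   of [S] do, and a vertex outside [S] keeps [2 d - j] out-neighbours outside. *)
pose F := [set v in S].
pose L := [set v in S | [forall y, gedge v y ==> (y \in S)]].
have card_F : #|F| = j.+1.
  by rewrite cardsE -sz_S; apply/card_uniqP.
have card_L : d < #|L|.
  apply: leq_trans (o_deg x) _.
  apply: leq_trans (leq_imset_card (fun v => nth x p1 (index v S)) L).
  apply/subset_leq_card/subsetP => y oxy.
  have [q1 [q2 E]] := mem_split (nbrs_x y (o_gedge oxy)); apply/imsetP; exists (last x q1).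
    rewrite inE; apply/andP; split; first by rewrite /S E -cat_cons mem_cat mem_last.
    apply/forallP=> z; apply/implyP; apply: rot_nbrs E _ z; exact: o_gedge.
  rewrite /S E -cat_cons index_cat mem_last index_last ?nth_cat ?ltnn ?subnn //.
  by move: Us1; rewrite E -cat_cons cat_uniq => /andP[].
have [ys [oys Uys Fys szys]] : exists ys, [/\ path o y1 ys, uniq (y1 :: ys),
    all [predC F] (y1 :: ys) & size ys = 2 * d - j].
  apply: greedy_dipath => [v vF|]; last first.
    by move: Us; rewrite -cat_cons cat_uniq inE => /and3P[_ /hasPn/(_ y1 (mem_head _ _))].
  have : #|o v| <= #|[pred w | o v w & w \notin F]| + #|F :\: L|.
    rewrite -[X in _ <= X + _]cardsE.
    apply: leq_trans (leq_card_setU _ _); apply/subset_leq_card/subsetP => w.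
    rewrite unfold_in => ovw; apply/setUP.
    have [wF | wF] := boolP (w \in F); last by left; rewrite inE; apply/andP; split.
    right; rewrite in_setD wF andbT inE negb_and; apply/orP; right.
    apply/forallP => /(_ v)/implyP; rewrite gedge_sym o_gedge // => /(_ isT).
    by move: vF; rewrite inE => /negP.
  have sLF : L \subset F by apply/subsetP=> w; rewrite !inE => /andP[].
  rewrite cardsD (setIidPr sLF); have := subset_leq_card sLF.
  have := o_deg v; rewrite card_F; clear -card_L lt_j.
  by move: #|o v| #|L| #|[pred w | _]| card_L => a b c; lia.
(* Rotating at [w] makes [v] the start, with second vertex [u1]; rotating at [v]
   makes [u1] a start, so that [v] and [u1] both have all their neighbours in
   [S]. *)
have [v [w [q1 [q2 [Ep1 gxv gxw]]]]] : exists v w q1 q2,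
    [/\ p1 = q1 ++ v :: w :: q2, gedge x v & gedge x w].
  have [|q1 [v [w [q2 [E gxv gxw]]]]] := @consecutive_pair _ (gedge x) (gedge x) p1.
    by have := deg_count nbrs_x; rewrite sz1; clear -lt_j; lia.
  by exists v, w, q1, q2.
have [u1 [r Eu1]] : exists u1 r, rev (x :: q1) = u1 :: r.
  by rewrite lastI rev_rcons; exists (last x q1), (rev (belast x q1)).
have Eu : u1 = last x q1 by move: Eu1; rewrite lastI rev_rcons => -[].
pose R := r ++ w :: q2.
have EpS : perm_eq (v :: u1 :: R) S.
  rewrite /R -[u1 :: _]cat_cons -Eu1 /S Ep1 -[v :: _]cat_cons -rev_rcons.
  by rewrite -[_ ++ v :: _]cat_rcons -[x :: _ ++ _]cat_cons -rcons_cons perm_cat2r perm_rev.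
have gR : path gedge v (u1 :: R).
  move: (gp1); rewrite Ep1 -cat_rcons => /rotate_path/(_ gxw).
  by rewrite last_rcons belast_rcons Eu1.
have lastR : last u1 R = last x p1 by rewrite /R Ep1 !last_cat.
have Nv y : gedge v y -> y \in v :: u1 :: R.
  rewrite (perm_mem EpS); have := @rot_nbrs (rcons q1 v) w q2.
  by rewrite last_rcons cat_rcons; apply.
have Nu y : gedge u1 y -> y \in v :: u1 :: R.
  by rewrite (perm_mem EpS) Eu; apply: rot_nbrs Ep1 gxv y.
have gneqF y : gedge y y = false by apply/negP=> /gedge_neq; rewrite eqxx.
have szR : (size R).+2 = j.+1 by rewrite -sz_S -(perm_size EpS).
have [|R1 [a [b [R2 [ER gva gub]]]]] := @consecutive_pair _ (gedge v) (gedge u1) R.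
  have count_R z z' : d < 0 + (gedge z z' + count (gedge z) R) -> d <= count (gedge z) R.
    by move=> lt_d; rewrite -ltnS (leq_trans lt_d) // add0n -add1n leq_add2r leq_b1.
  have cv : d <= count (gedge v) R.
    by apply: (count_R v u1); have := deg_count Nv; rewrite /= gneqF.
  have cu : d <= count (gedge u1) R.
    by apply: (count_R u1 v); have := deg_count Nu; rewrite /= gneqF addnCA.
  by apply: leq_trans (leq_add cv cu); clear -szR lt_j; lia.
have [ys' [t Eys]] : exists ys' t, ys = rcons ys' t.
  case/lastP: (ys) szys => [/esym/eqP | ys' t _]; last by exists ys', t.
  by rewrite subn_eq0 leqNgt lt_j.
have hamilton h Q : perm_eq (v :: h :: Q) S -> path gedge v (h :: Q) ->
    last h Q = last x p1 -> col v t = col v h.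
  move=> EpQ gQ lastQ.
  apply: (@closing_color v h t (Q ++ y1 :: ys')).
  - rewrite rcons_cat rcons_cons -Eys -!cat_cons cat_uniq Uys (perm_uniq EpQ) Us1.
    rewrite andbT andTb; apply/hasPn => y /(allP Fys); rewrite !inE /=.
    by rewrite -!in_cons (perm_mem EpQ).
  - rewrite rcons_cat rcons_cons -Eys -cat_cons cat_path gQ /= lastQ gl1.
    exact: sub_path o_gedge _ _ oys.
  - by move: oys; rewrite last_cat /= Eys rcons_path => /andP[].
  - rewrite size_cat; move: (perm_size EpQ) szys; rewrite sz_S Eys size_rcons /=.
    by clear -lt_j; lia.
have Ec : col v u1 = col v a.
  rewrite -(hamilton u1 R EpS gR lastR).
  apply: (hamilton a (rev (u1 :: R1) ++ b :: R2)).
  - apply: perm_trans EpS; rewrite ER perm_cons.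
    have -> : u1 :: R1 ++ [:: a, b & R2] = rcons (u1 :: R1) a ++ b :: R2.
      by rewrite cat_rcons.
    by rewrite -cat_cons -rev_rcons perm_cat2r perm_rev.
  - move: gR; rewrite /= gva ER cat_path /= => /and5P[_ gR1 gRa _ gR2].
    rewrite cat_path; apply/andP; split.
      have := rev_path gedge u1 (rcons R1 a); rewrite last_rcons belast_rcons => ->.
      rewrite (eq_path (e' := gedge)) ?rcons_path ?gR1 //.
      by move=> y z; rewrite gedge_sym.
    by rewrite rev_cons last_rcons /= gub.
  - by rewrite -lastR ER !last_cat.
have gvu : gedge v u1 by case/andP: gR.
have [[_ Eua] | [Eva _]] := gedge_col gvu gva Ec; last first.
  by move: gva; rewrite -Eva gneqF.
have := perm_uniq EpS; rewrite Us1 /= ER => /andP[_ /andP[]].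
by rewrite mem_cat -Eua mem_head orbT.
Qed.

(** Consider a longest path of [H - u] that ends at [u1].  All the neighbours of
    its start [e] are on it, [u] apart, and [u] has many neighbours on it, since
    few vertices of [H] are left over; rotating at consecutive vertices [a], [b]
    with [u] adjacent to [a] and [e] to [b] makes [u] the new start. *)
Lemma path_in_closed (H : {set V}) (u u1 : V) :
    (forall x y, gedge x y -> x \in H -> y \in H) -> #|H| <= 2 * d ->
    u \in H -> u1 \in H -> u != u1 ->
  exists p, [/\ uniq (u :: p), path gedge u p, last u p = u1, d < size p
              & {subset p <= H}].
Proof.
move=> closedH le_H uH u1H nuu1.
pose Q k := exists (e : V) (q : seq V), [/\ uniq (e :: q), path gedge e q,
  last e q = u1, {subset e :: q <= H :\ u} & size q = k].
have [||k [e [q [Us gq lq sH sz]]] maxQ] := @exists_max Q #|V|.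
- exists 0, u1, [::]; split=> // y; rewrite inE => /eqP->.
  by rewrite in_setD1 eq_sym nuu1.
- move=> _ [e [q [/card_uniqP Us _ _ _ <-]]].
  by apply: ltnW; rewrite -[_.+1]Us max_card.
have eH : e \in H by have /setD1P[] := sH e (mem_head _ _).
have nbr_e y : gedge e y -> y \in u :: q.
  move=> gey; rewrite inE; have [//|nyu] := eqVneq y u.
  apply/negPn/negP=> /= yq.
  suff /maxQ : Q k.+1 by rewrite ltnn.
  exists y, (e :: q); split=> //=.
  - by move: Us => /= ->; rewrite inE negb_or yq eq_sym (gedge_neq gey).
  - by rewrite gedge_sym gey.
  - move=> z; rewrite inE => /predU1P[-> | /sH //].
    by rewrite in_setD1 nyu (closedH _ _ gey).
  - by rewrite sz.
have cnt_e : d < 1 + count (gedge e) (e :: q).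
  apply: leq_trans (deg_count nbr_e) _; rewrite /= leq_add ?leq_b1 //.
  exact: leq_addl.
have cnt_u : d + k + 3 <= count (gedge u) (e :: q) + 2 * d.
  have : #|o u| <= count (gedge u) (e :: q) + #|(H :\ u) :\: [set z in e :: q]|.
    rewrite -size_filter -(card_uniqP (filter_uniq _ Us)) -[X in _ <= X + _]cardsE.
    apply: leq_trans (leq_card_setU _ _); apply/subset_leq_card/subsetP => w.
    rewrite unfold_in => ouw; apply/setUP.
    have [wq | wq] := boolP (w \in e :: q); [left | right].
      by rewrite inE mem_filter wq o_gedge.
    by rewrite in_setD in_setD1 inE wq eq_sym o_neq // (closedH _ _ (o_gedge ouw)).
  have sub : [set z in e :: q] \subset H :\ u.
    by apply/subsetP=> z; rewrite inE => /sH.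
  have card_q : #|[set z in e :: q]| = k.+1.
    by rewrite cardsE -sz; apply/card_uniqP.
  rewrite cardsD (setIidPr sub) card_q.
  have := cardsD1 u H; rewrite uH; have := subset_leq_card sub.
  rewrite card_q; have := o_deg u; clear -le_H.
  by move: #|o u| #|H| #|H :\ u| (count (gedge u) (e :: q)) le_H => a b c n; lia.
have [|Q1 [a [b [Q2 [Eq gua geb]]]]] := @consecutive_pair _ (gedge u) (gedge e) (e :: q).
  rewrite [size _]/= sz; move: cnt_e cnt_u; clear.
  by move: (count _ _) (count _ _) => m n; lia.
have [r [Er lr]] : exists r, e :: r = rcons Q1 a /\ last e r = a.
  case: Q1 Eq => [[-> _]|e' Q1 [-> _]]; first by exists [::].
  by exists (rcons Q1 a); rewrite last_rcons.
have Eq' : e :: q = (e :: r) ++ b :: Q2 by rewrite Er cat_rcons.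
have Ep : perm_eq (rev (e :: r) ++ b :: Q2) (e :: q) by rewrite Eq' perm_cat2r perm_rev.
exists (rev (e :: r) ++ b :: Q2); split.
- rewrite cons_uniq (perm_uniq Ep) Us andbT (perm_mem Ep).
  by apply/negP=> /sH; rewrite in_setD1 eqxx.
- move: gq; case: Eq' => ->; rewrite cat_path => /andP[gr /= /andP[_ gQ2]].
  rewrite cat_path rev_cons last_rcons /= geb gQ2 !andbT.
  rewrite -rev_cons lastI rev_rcons /= lr gua /=.
  rewrite -[X in path _ X]lr rev_path (eq_path (e' := gedge)) //.
  by move=> y z; rewrite gedge_sym.
- by rewrite -lq last_cat; case: Eq' => ->; rewrite last_cat.
- rewrite (perm_size Ep) /= sz; have := deg_count nbr_e.
  by move/leq_trans; apply; rewrite -sz; exact: (count_size _ (u :: q)).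
- by move=> z; rewrite (perm_mem Ep) => /sH/setD1P[].
Qed.
End PrivateGraph.

(** * Colours within a set of vertices *)

Section EdgeColors.

Variables (V C : finType) (f : {set V} -> C).

Definition pairs (U : {set V}) : {set {set V}} :=
  [set A : {set V} | A \subset U & #|A| == 2].

Definition colors_in (U : {set V}) : {set C} := f @: pairs U.

Lemma card_pairs (U : {set V}) : #|pairs U| = 'C(#|U|, 2).
Proof. exact: cards_draws. Qed.

Lemma mem_pairs (U : {set V}) x y :
  ([set x; y] \in pairs U) = [&& x \in U, y \in U & x != y].
Proof. by rewrite inE subUset !sub1set cards2 -andbA; case: (x != y). Qed.

Lemma colors_inP (U : {set V}) a :
  reflect (exists x y, [/\ x \in U, y \in U, x != y & f [set x; y] = a])
          (a \in colors_in U).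
Proof.
apply: (iffP imsetP) => [[A + ->] | [x [y [xU yU nxy <-]]]].
  rewrite inE => /andP[sAU /cards2P[x [y [nxy EA]]]]; subst A.
  move: sAU; rewrite subUset !sub1set => /andP[xU yU].
  by exists x, y.
by exists [set x; y] => //; rewrite mem_pairs xU yU.
Qed.

Lemma card_colors_in (U : {set V}) : #|colors_in U| <= 'C(#|U|, 2).
Proof. by rewrite -card_pairs leq_imset_card. Qed.

Lemma colors_inS (U W : {set V}) : U \subset W -> colors_in U \subset colors_in W.
Proof.
move=> sUW; apply/imsetS/subsetP => A; rewrite !inE => /andP[sAU ->].
by rewrite (subset_trans sAU sUW).
Qed.

Lemma set2_eq (x y z t : V) : [set x; y] = [set z; t] ->
  (x = z /\ y = t) \/ (x = t /\ y = z).
Proof.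
move=> /setP E; have := E x; have := E y; have := E z; have := E t.
rewrite !inE !eqxx ?orbT /= => /orP ht /orP hz /esym/orP hy /esym/orP hx.
case: hx => /eqP Ex; [left | right]; split=> //; subst.
  by case: ht => /eqP; case: hy => /eqP; congruence.
by case: hz => /eqP; case: hy => /eqP; congruence.
Qed.

End EdgeColors.

(** * Colourings without rainbow cycles of lengths 2d+1 and 2d+2 *)

(** The last two hypotheses describe a smallest colouring with more than
    [d (n - 1)] colours: the bound holds on every smaller set of vertices. *)
Section MinimalCounterexample.

Variables (V C : finType) (f : {set V} -> C) (d : nat).
Let col (x y : V) : C := f [set x; y].
Hypothesis d_ge2 : 1 < d.
Hypothesis no_rainbow : forall s : seq V,
  size s = (2 * d).+1 \/ size s = (2 * d).+2 -> ~~ rainbow_cycle col s.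
Hypothesis many_colors : d * #|V|.-1 < #|colors_in f setT|.
Hypothesis few_outside : forall H : {set V}, H != set0 -> H != setT ->
  #|colors_in f (~: H)| <= d * #|~: H|.-1.

Let colC x y : col x y = col y x.
Proof. by rewrite /col setUC. Qed.

Definition lost (H : {set V}) := colors_in f setT :\: colors_in f (~: H).

Lemma card_lost H : H != set0 -> H != setT -> d * #|H| < #|lost H|.
Proof.
move=> H0 HT; rewrite cardsD (setIidPr (colors_inS f (subsetT _))).
have CH_gt0 : 0 < #|~: H|.
  rewrite lt0n cards_eq0; apply: contraNneq HT => E.
  by rewrite -[H]setCK E setC0.
have := few_outside H0 HT; have := cardsC H; move: CH_gt0 many_colors; clear.
by move: #|H| #|~: H| #|V| #|colors_in f _| #|colors_in f _| => h k n x y; nia.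
Qed.

(** Choosing one edge per colour makes distinct chosen edges differ in colour. *)
Definition rep (a : C) : option {set V} := [pick A in pairs setT | f A == a].

Definition private_edge : rel V := fun x y =>
  [&& x != y, rep (col x y) == Some [set x; y]
    & [forall A in pairs setT, (f A == col x y) ==> (x \in A)]].
Local Notation o := private_edge.

Lemma private_edge_neq x y : o x y -> x != y.
Proof. by case/and3P. Qed.

Lemma private_edge_private x y z t :
  o x y -> z != t -> col z t = col x y -> (x == z) || (x == t).
Proof.
case/and3P=> _ _ /forall_inP pr nzt /eqP E.
by have := pr [set z; t]; rewrite mem_pairs !inE nzt E; apply.
Qed.

Lemma private_edge_rep x y : gedge o x y -> rep (col x y) = Some [set x; y].
Proof. by case/orP => /and3P[_ /eqP E _] //; rewrite colC setUC. Qed.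

Lemma private_edge_col x y z t : gedge o x y -> gedge o z t ->
  col x y = col z t -> (x = z /\ y = t) \/ (x = t /\ y = z).
Proof.
move=> /private_edge_rep Exy /private_edge_rep + E.
by rewrite -E Exy => -[/set2_eq].
Qed.

(** A colour whose edges all contain [v] is private to [v], and is represented by
    an edge at [v]. *)
Lemma star_color v a : a \in colors_in f setT ->
    (forall x y, x != y -> col x y = a -> (v == x) || (v == y)) ->
  exists2 y, o v y & col v y = a.
Proof.
case/imsetP=> A0 A0T Ea star.
have [A [AT EA Erep]] : exists A, [/\ A \in pairs setT, f A = a & rep a = Some A].
  rewrite /rep; case: pickP => [A /andP[AT /eqP EA] | /(_ A0)]; first by exists A.
  by rewrite /= A0T Ea eqxx.
have star' B : B \in pairs setT -> f B = a -> v \in B.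
  rewrite inE subsetT => /cards2P[x [y [nxy ->]]] /(star _ _ nxy).
  by rewrite !inE.
have [y nvy Ey] : exists2 y, v != y & A = [set v; y].
  have := star' A AT EA; move: AT; rewrite inE subsetT => /cards2P[x [y [nxy ->]]].
  rewrite !inE => /orP[]/eqP->; first by exists y.
  by exists x; rewrite 1?eq_sym // setUC.
exists y; last by rewrite /col -Ey.
rewrite /o nvy /col -Ey EA Erep eqxx /=; apply/forall_inP=> B BT.
by apply/implyP=> /eqP; apply: star'.
Qed.

Lemma card_V_gt1 : 1 < #|V|.
Proof.
rewrite ltnNge; apply/negP => le1.
have := leq_trans many_colors (card_colors_in f setT).
by rewrite cardsT bin_small // ltnS.
Qed.

Lemma private_edge_deg x : d < #|o x|.
Proof.
have := @card_lost [set x]; rewrite cards1 muln1 => lt_d.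
apply: leq_trans (lt_d _ _) _.
- by rewrite -card_gt0 cards1.
- by apply/eqP=> E; have := card_V_gt1; rewrite -cardsT -E cards1.
apply: leq_trans (leq_imset_card (col x) (o x)).
apply/subset_leq_card/subsetP => a /setDP[aT aN].
have [|y oxy <-] := @star_color x a aT; last exact: imset_f.
move=> y z nyz E; apply/negPn/negP; rewrite negb_or => /andP[nxy nxz].
case/negP: aN; apply/colors_inP; exists y, z.
by rewrite !inE eq_sym nxy eq_sym nxz.
Qed.

Section ClosedSet.

Variable H : {set V}.
Hypothesis H_neq0 : H != set0.
Hypothesis card_H : #|H| <= 2 * d.
Hypothesis closedH : forall x y, gedge o x y -> x \in H -> y \in H.

Let closed_eq x y : gedge o x y -> (x \in H) = (y \in H).
Proof. by move=> gxy; apply/idP/idP; apply: closedH; rewrite // gedge_sym. Qed.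

Let card_colors_H : #|colors_in f H| <= d * #|H|.-1.
Proof.
apply: leq_trans (card_colors_in _ _) _; rewrite bin2.
have := half_leq (leq_mul card_H (leqnn #|H|.-1)).
by rewrite -mulnA mul2n doubleK.
Qed.

(** The colours that occur only between [H] and its complement. *)
Definition crossing_colors := lost H :\: colors_in f H.

Lemma H_neqT : H != setT.
Proof.
apply/eqP=> E; have := many_colors; rewrite ltnNge => /negP[].
by rewrite -E -cardsT -E.
Qed.

Lemma card_crossing : 2 < #|crossing_colors|.
Proof.
have := card_lost H_neq0 H_neqT; have := H_neq0; rewrite -card_gt0.
have := card_colors_H; have := cardsD (lost H) (colors_in f H).
have := subset_leq_card (subsetIr (lost H) (colors_in f H)).
rewrite -/crossing_colors -subn1; move: d_ge2; clear.
by move: #|H| #|lost H| #|colors_in f H| #|_ :&: _| #|crossing_colors|; nia.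
Qed.

Lemma crossing_colorP a x y : a \in crossing_colors -> x != y -> col x y = a ->
  (x \in H) = (y \notin H).
Proof.
case/setDP=> /setDP[_ aN1] aN2 nxy E.
case xH: (x \in H); case yH: (y \in H) => //.
  by case/negP: aN2; apply/colors_inP; exists x, y.
by case/negP: aN1; apply/colors_inP; exists x, y; rewrite !inE xH yH.
Qed.

(** Otherwise the colour is private to [v], and its chosen edge leaves the closed
    set [H] or enters it. *)
Lemma crossing_color_avoid a v : a \in crossing_colors ->
  exists u w, [/\ u \in H, w \notin H, col u w = a, u != v & w != v].
Proof.
move=> aK; apply: contrapT => noE.
have aT : a \in colors_in f setT by case/setDP: aK => /setDP[].
have [|y ovy E] := star_color aT (v := v).
  move=> x y nxy E; apply/negPn/negP; rewrite negb_or => /andP[nvx nvy]; case: noE.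
  have := crossing_colorP aK nxy E.
  case xH: (x \in H) => /esym yH.
    by exists x, y; split; rewrite 1?eq_sym.
  by exists y, x; split; rewrite ?xH 1?colC 1?eq_sym //; move/negbFE: yH.
have := crossing_colorP aK (private_edge_neq ovy) E.
by rewrite (closed_eq (o_gedge ovy)); case: (y \in H).
Qed.

(** A bipartite colour class with no common vertex contains two disjoint edges. *)
Lemma crossing_color_matching a : a \in crossing_colors ->
  exists p x q y, [/\ [/\ p \in H, x \notin H, q \in H & y \notin H],
    p != q, x != y, col p x = a & col q y = a].
Proof.
move=> aK; have [v0 _] := set0Pn _ H_neq0.
have [p [x [pH xH Epx _ _]]] := crossing_color_avoid v0 aK.
have [q [y [qH yH Eqy nqp _]]] := crossing_color_avoid p aK.
have [Exy | nxy] := eqVneq x y; last first.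
  by exists p, x, q, y; split; rewrite // eq_sym.
have [r [z [rH zH Erz _ nzx]]] := crossing_color_avoid x aK.
have [Epr | npr] := eqVneq p r; last by exists p, x, r, z; split; rewrite // eq_sym.
by exists q, y, r, z; split; rewrite // -?Epr // -Exy eq_sym.
Qed.

(** Let [px] and [qy] be disjoint edges of one crossing colour.  If every edge of
    a second colour meets both, then an edge of the second colour that avoids
    [q] must be [py].  This cannot happen for two further colours. *)
Lemma disjoint_crossing_edges : exists u w u' w',
  [/\ [/\ u \in H, w \notin H, u' \in H & w' \notin H], u != u', w != w',
      col u w != col u' w'
    & col u w \in crossing_colors /\ col u' w' \in crossing_colors].
Proof.
have [a [b [b' [[aK bK bK'] [nab nbb' nba]]]]] := card_gt2P card_crossing.
have [p [x [q [y [[pH xH qH yH] npq nxy Epx Eqy]]]]] := crossing_color_matching aK.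
apply: contrapT => noE.
suff Epy e : e \in crossing_colors -> a != e -> col p y = e.
  by case/eqP: nbb'; rewrite -(Epy b) // -(Epy b') // eq_sym.
rewrite eq_sym => eK nea; have [r [z [rH zH Erz nrq nzq]]] := crossing_color_avoid q eK.
have Ezy : z = y.
  apply/eqP/negPn/negP => nzy; case: noE; exists r, z, q, y.
  by rewrite Erz Eqy.
suff Erp : r = p by rewrite -Erp -Ezy.
apply/eqP/negPn/negP => nrp; case: noE; exists r, z, p, x.
rewrite Erz Epx Ezy [y == x]eq_sym; split=> //.
Qed.

(** The cycle runs from [w1] along a directed path outside [H], by an arbitrary
    edge to [w2], into [H] at [u2], through [H] to [u1] and back to [w1].  The
    path in [H] has between [d + 2] and [2 d] vertices, and the greedy path
    outside supplies the missing ones, [2 d + 2] in total. *)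
Lemma closed_contradiction : False.
Proof.
have [u1 [w1 [u2 [w2 [[u1H w1H u2H w2H] nu nw nc [K1 K2]]]]]] := disjoint_crossing_edges.
have nu' : u2 != u1 by rewrite eq_sym.
have [p [Up gp lp sz_p pH]] := path_in_closed private_edge_neq private_edge_deg
  closedH card_H u2H u1H nu'.
have pH' : {subset u2 :: p <= H} by move=> z; rewrite inE => /predU1P[-> | /pH].
have le_p : size (u2 :: p) <= 2 * d.
  apply: leq_trans card_H; rewrite -(card_uniqP Up).
  exact/subset_leq_card/subsetP.
pose F := w2 |: H.
have w1F : w1 \notin F by rewrite !inE negb_or nw.
have outF v : v \notin F -> 2 * d - size (u2 :: p) <= #|[pred w | o v w & w \notin F]|.
  rewrite !inE negb_or => /andP[_ vH].
  have : #|o v| <= #|[pred w | o v w & w \notin F]| + #|[set w2]|.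
    rewrite -[X in _ <= X + _]cardsE.
    apply: leq_trans (leq_card_setU _ _); apply/subset_leq_card/subsetP => w.
    move=> ovw; have {}ovw : o v w := ovw; apply/setUP.
    have [-> | nww2] := eqVneq w w2; first by right; rewrite inE.
    left; rewrite inE; apply/andP; split=> //.
    by rewrite !inE negb_or nww2 -(closed_eq (o_gedge ovw)).
  rewrite cards1 => le_o; have := leq_trans (private_edge_deg v) le_o.
  by move: sz_p => /=; clear; lia.
have [ws [ows Uws Fws szws]] := greedy_dipath private_edge_neq outF w1F.
have wsH y : y \in w1 :: ws -> y \notin H /\ y != w2.
  by move/(allP Fws); rewrite /= !inE negb_or => /andP[-> ->].
have [lwH lww2] := wsH _ (mem_last w1 ws).
set t := last w1 ws in lwH lww2.
pose P := pairmap col w1 ws; pose Q := pairmap col u2 p.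
have gws : path (gedge o) w1 ws := sub_path (@o_gedge _ o) ows.
have Pout a : a \in P -> exists y z, [/\ a = col y z, o y z, y != t, y != w2
    & (y \notin H) && (z \notin H)].
  case/(mem_pairmap ows) => y [z [Ea oyz yb zin]]; exists y, z.
  have [yH nyw2] := wsH _ (mem_belast yb).
  rewrite yH (wsH z _).1 ?inE ?zin ?orbT //; split=> //.
  apply: contraTneq yb => ->; move: Uws; rewrite lastI rcons_uniq.
  by case/andP.
have Qin a : a \in Q ->
    exists y z, [/\ a = col y z, gedge o y z, y \in H & z \in H].
  case/(mem_pairmap gp) => y [z [Ea gyz yb zin]]; exists y, z; split=> //.
    exact/pH'/mem_belast.
  exact: pH.
have crossP a : a \in crossing_colors -> (a \notin P) && (a \notin Q).
  move=> aK; apply/andP; split; apply/negP.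
    case/Pout=> y [z [Ea oyz _ _ /andP[yH zH]]].
    have := crossing_colorP aK (private_edge_neq oyz) (esym Ea).
    by rewrite (negPf yH) zH.
  case/Qin=> y [z [Ea gyz yH zH]].
  have := crossing_colorP aK (gedge_neq private_edge_neq gyz) (esym Ea).
  by rewrite yH zH.
have crossT a : a \in crossing_colors -> a != col t w2.
  move=> aK; apply/eqP => Ea.
  have := crossing_colorP aK lww2 (esym Ea).
  by rewrite (negPf lwH) w2H.
have /negP[] : ~~ rainbow_cycle col (w1 :: ws ++ w2 :: u2 :: p).
  apply: no_rainbow; right; rewrite /= size_cat /= szws.
  by move: le_p => /=; clear; lia.
rewrite /rainbow_cycle; apply/andP; split.
  rewrite -cat_cons cat_uniq Uws cons_uniq Up andbT andTb; apply/andP; split.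
    apply/hasPn => y; rewrite inE => /predU1P[-> | /pH' yH]; apply/negP => /wsH[].
      by rewrite eqxx.
    by rewrite yH.
  by apply/negP=> /pH'; apply/negP.
rewrite /= rcons_cat pairmap_cat -/P /= -/t pairmap_rcons lp -/Q.
have perm_colors : perm_eq (P ++ col t w2 :: col w2 u2 :: rcons Q (col u1 w1))
    [:: col t w2, col u2 w2, col u1 w1 & P ++ Q].
  rewrite perm_catC /= perm_cons [col w2 u2]colC perm_cons -cats1 -catA.
  by rewrite perm_catC.
rewrite (perm_uniq perm_colors) /= !inE !negb_or !mem_cat !negb_or.
have [/andP[-> ->] /andP[-> ->]] := (crossP _ K1, crossP _ K2).
rewrite eq_sym (crossT _ K2) eq_sym (crossT _ K1) eq_sym nc /=.
have tQ a : a \in Q -> a != col t w2.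
  case/Qin=> y [z [Ea gyz yH zH]]; apply/eqP; rewrite Ea => E.
  have out v : v \in H -> (v == t) || (v == w2) = false.
    by move=> vH; apply/negP=> /orP[]/eqP Ev; [move: lwH | move: w2H]; rewrite -Ev vH.
  case/orP: gyz => [oyz | ozy].
    by have := private_edge_private oyz lww2 (esym E); rewrite out.
  by have := private_edge_private ozy lww2 (etrans (esym E) (colC _ _)); rewrite out.
have tP a : a \in P -> a != col t w2.
  case/Pout=> y [z [Ea oyz nyt nyw2 _]]; apply/eqP; rewrite Ea => E.
  by have := private_edge_private oyz lww2 (esym E); rewrite (negPf nyt) (negPf nyw2).
have colors_uniq := uniq_path_colors private_edge_col.
apply/andP; split.
  by apply/andP; split; apply/negP; [move/tP | move/tQ]; rewrite eqxx.
rewrite cat_uniq !colors_uniq //= andbT; apply/hasPn => a /Qin[y [z [Ea gyz yH zH]]].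
apply/negP=> /Pout[y' [z' [Ea' oyz' _ _ /andP[yH' zH']]]].
have := private_edge_col gyz (o_gedge oyz'); rewrite -Ea -Ea' => /(_ erefl).
by case=> -[Ey _]; [move: yH' | move: zH']; rewrite -Ey yH.
Qed.

End ClosedSet.

Lemma no_counterexample : False.
Proof.
have [v0 _] : exists v : V, v \in [set: V].
  by apply/card_gt0P; rewrite cardsT ltnW // card_V_gt1.
have [H [H0 cH clH]] := closed_set colC d_ge2 no_rainbow private_edge_neq
  private_edge_private private_edge_col private_edge_deg v0.
exact: (@closed_contradiction H).
Qed.

End MinimalCounterexample.

(** The bound passes to the complement of a proper set [H] by induction, since
    the restricted colouring still has no rainbow cycle of these lengths. *)
Theorem card_colors_no_rainbow_cycle (V C : finType) (f : {set V} -> C) (d : nat) :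
    1 < d -> 0 < #|V| ->
    (forall s : seq V, size s = (2 * d).+1 \/ size s = (2 * d).+2 ->
       ~~ rainbow_cycle (fun x y => f [set x; y]) s) ->
  #|colors_in f setT| <= d * #|V|.-1.
Proof.
move=> d_ge2; have [n] := ubnP #|V|; elim: n V f => // n IHn V f le_Vn V_gt0 norb.
rewrite leqNgt; apply/negP => many; apply: (no_counterexample d_ge2 norb many).
move=> H H0 HT; pose W : finType := {x : V | x \notin H}.
pose fW (A : {set W}) := f (val @: A).
have cardW : #|W| = #|~: H|.
  by rewrite card_sig; apply: eq_card => x; rewrite !inE.
have -> : colors_in f (~: H) = colors_in fW setT.
  apply/setP=> a; apply/colors_inP/colors_inP => [[x [y []]] | [x [y [_ _ nxy <-]]]].
    rewrite !inE => xH yH nxy <-; exists (Sub x xH), (Sub y yH).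
    by rewrite !inE -val_eqE /= /fW imsetU1 imset_set1.
  exists (val x), (val y); rewrite !inE (valP x) (valP y) val_eqE nxy.
  by rewrite /fW imsetU1 imset_set1.
rewrite -cardW; apply: IHn.
- have := cardsC H; rewrite -cardW; have := H0; rewrite -card_gt0.
  by move: le_Vn; clear; lia.
- rewrite cardW lt0n cards_eq0; apply: contraNneq HT => E.
  by rewrite -[H]setCK E setC0.
move=> s sz; apply/negP=> /andP[Us Uc].
have /negP[] : ~~ rainbow_cycle (fun x y => f [set x; y]) (map val s).
  by apply: norb; rewrite size_map.
rewrite /rainbow_cycle map_inj_uniq ?Us; last exact: val_inj.
suff -> : cycle_colors (fun x y => f [set x; y]) (map val s)
    = cycle_colors (fun x y => fW [set x; y]) s by [].
case: (s) => //= x p; rewrite -map_rcons.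
by move: (rcons p x) => q; elim: q x => //= y q IHq x; rewrite IHq /fW imsetU1 imset_set1.
Qed.

(** * Sets of vertices on a cycle *)

Section CycleSets.

Variables (V : finType) (s : seq V).
Hypothesis Us : uniq s.

Lemma next_inj : injective (next s).
Proof. exact: can_inj (prev_next Us). Qed.

(** [X] and the set of its successors are two sets of the same size on the cycle;
    their intersection counts the edges of the cycle inside [X]. *)
Lemma consecutive_in_set (X : {set V}) : {subset X <= s} ->
  2 * #|X| <= #|[set x in X | next s x \in X]| + size s.
Proof.
move=> sXs; rewrite mul2n -addnn -{2}(card_imset (mem X) next_inj) -cardsUI.
rewrite addnC leq_add //.
  rewrite -[X in _ <= X](card_imset _ next_inj); apply/subset_leq_card/subsetP => y.
  case/setIP=> yX /imsetP[x xX Ey]; apply/imsetP; exists x => //.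
  by rewrite inE xX -Ey.
rewrite -(card_uniqP Us); apply/subset_leq_card/subsetP => y.
by case/setUP=> [/sXs // | /imsetP[x /sXs xs ->]]; rewrite mem_next.
Qed.

Lemma next_next_neq x : 2 < size s -> x \in s -> next s (next s x) != x.
Proof.
move=> sz xs; have [i r E] := rot_to xs.
rewrite -!(next_rot i Us) E.
have : size (x :: r) = size s by rewrite -E size_rot.
have : uniq (x :: r) by rewrite -E rot_uniq.
case: r {E} => [|y [|z r]] /=; [by move=> _ E; rewrite -E in sz.. |].
rewrite !inE !negb_or eqxx => /andP[/and3P[nxy nxz _] _] _.
by rewrite [y == x]eq_sym (negPf nxy) eqxx eq_sym.
Qed.

Lemma cycle_edge_inj : 2 < size s ->
  {in s &, injective (fun x => [set x; next s x])}.
Proof.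
move=> sz x y xs ys /set2_eq [[//] | [Ex Ey]].
by have := next_next_neq sz ys; rewrite -Ex Ey eqxx.
Qed.

End CycleSets.

Lemma next_last (T : eqType) (y : T) r :
  uniq (y :: r) -> next (y :: r) (last y r) = y.
Proof. by move=> Ur; rewrite next_nth mem_last index_last // nth_default. Qed.

Section ExtendCycle.

Variables (V C : finType) (f : {set V} -> C).
Let col (x y : V) : C := f [set x; y].
Let colC x y : col x y = col y x.
Proof. by rewrite /col setUC. Qed.

(** The path from [x] to its successor through [w] replaces the edge between
    them. *)
Lemma insert_vertex s w x : rainbow_cycle col s -> w \notin s -> x \in s ->
    col w x != col w (next s x) -> 
    col w x \notin cycle_colors col s -> col w (next s x) \notin cycle_colors col s ->
  exists2 s', rainbow_cycle col s' & size s' = (size s).+1.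
Proof.
move=> rs ws xs nxy xN yN; have [Us _] := andP rs.
have ys : next s x \in s by rewrite mem_next.
have [i r E] := rot_to ys.
have Ur : uniq (next s x :: r) by rewrite -E rot_uniq.
have lr : last (next s x) r = x.
  by apply: (next_inj Us); rewrite -(next_rot i Us (last _ _)) E next_last.
have colors_r : {subset pairmap col (next s x) r <= cycle_colors col s}.
  move=> a ar; have : a \in cycle_colors col (next s x :: r).
    by rewrite /= pairmap_rcons mem_rcons inE ar orbT.
  rewrite !cycle_colorsE // -E => /mapP[z zs ->]; apply/mapP.
  by exists z; rewrite ?next_rot //; move: zs; rewrite mem_rot.
have Uc : uniq (pairmap col (next s x) r).
  have /andP[_] : rainbow_cycle col (next s x :: r).
    apply/rainbow_cycleP; split=> // a b; rewrite -E !mem_rot !next_rot //.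
    by have /rainbow_cycleP[_] := rs; apply.
  by rewrite /= pairmap_rcons rcons_uniq => /andP[].
exists (w :: next s x :: r); last by rewrite -E /= size_rot.
rewrite /rainbow_cycle cons_uniq Ur -E mem_rot ws /= E /=.
rewrite pairmap_rcons lr mem_rcons rcons_uniq inE negb_or Uc andbT [col x w]colC.
rewrite eq_sym nxy /=; apply/andP; split; apply/negP=> /colors_r; exact/negP.
Qed.
End ExtendCycle.

(** * Colourings around a rainbow cycle of length 2d+1 *)

Lemma card_bigcup_le (I T : finType) (A : {set I}) (F : I -> {set T}) :
  #|\bigcup_(i in A) F i| <= \sum_(i in A) #|F i|.
Proof.
elim/big_rec2: _ => [|i m B _ le_m]; first by rewrite cards0.
by apply: leq_trans (leq_card_setU _ _) _; rewrite leq_add2l.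
Qed.

Lemma bin2_odd d : 'C((2 * d).+1, 2) = d * (2 * d).+1.
Proof. by rewrite bin2 /= mulnC -mulnA mul2n doubleK. Qed.

Lemma exists_reps (T C : finType) (h : T -> C) (S : {set T}) (N : {set C}) :
    N \subset h @: S ->
  exists2 R : {set T}, R \subset S & {in R &, injective h} /\ h @: R = N.
Proof.
move=> sNS; pose r a := [pick x in S | h x == a].
exists [set x in S | (r (h x) == Some x) && (h x \in N)].
  by apply/subsetP=> x; rewrite inE => /andP[].
split=> [x y|].
  by rewrite !inE => /and3P[_ /eqP Ex _] /and3P[_ /eqP Ey _] E; move: Ex; rewrite E Ey => -[].
apply/setP=> a; apply/imsetP/idP => [[x + ->] | aN]; first by rewrite inE => /and3P[].
have /imsetP[x0 x0S Ea] := subsetP sNS a aN.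
have [x [xS Ex Er]] : exists x, [/\ x \in S, h x = a & r a = Some x].
  rewrite /r; case: pickP => [x /andP[xS /eqP E] | /(_ x0)]; first by exists x.
  by rewrite x0S Ea eqxx.
by exists x; rewrite // inE xS Ex Er eqxx.
Qed.

Section AroundCycle.

Variables (V C : finType) (f : {set V} -> C) (d : nat) (s : seq V).
Let col (x y : V) : C := f [set x; y].
Hypothesis d_ge2 : 1 < d.
Hypothesis rainbow_s : rainbow_cycle col s.
Hypothesis size_s : size s = (2 * d).+1.

Let colC x y : col x y = col y x.
Proof. by rewrite /col setUC. Qed.

Let Us : uniq s. Proof. by case/andP: rainbow_s. Qed.

Let S : {set V} := [set z in s].

Let card_S : #|S| = (2 * d).+1.
Proof. by rewrite cardsE -size_s; apply/card_uniqP. Qed.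

Let S_s : {subset S <= s}. Proof. by move=> x; rewrite inE. Qed.

Let size_gt2 : 2 < size s. Proof. by rewrite size_s; lia. Qed.

Let next_S x : (next s x \in S) = (x \in S).
Proof. by rewrite !inE mem_next. Qed.

Let next_neq x : x \in s -> x != next s x.
Proof.
move=> xs; apply/eqP=> E; have := next_next_neq Us size_gt2 xs.
by rewrite -!E eqxx.
Qed.

Let next_col x : x \in s -> col x (next s x) \in cycle_colors col s.
Proof. by move=> xs; rewrite cycle_colorsE //; apply: map_f. Qed.

Let cycle_colors_sub : {subset cycle_colors col s <= colors_in f S}.
Proof.
move=> a; rewrite cycle_colorsE // => /mapP[x xs ->].
by apply/colors_inP; exists x, (next s x); rewrite next_S inE xs next_neq.
Qed.

Definition new_colors w : {set C} := [set col w x | x in S] :\: colors_in f S.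

Lemma card_colors_around :
    (forall u v, u \notin S -> v \notin S -> u != v ->
      col u v \in colors_in f S :|: new_colors u) ->
  #|colors_in f setT| <= #|colors_in f S| + \sum_(w in ~: S) #|new_colors w|.
Proof.
move=> outer; apply: leq_trans (leq_add (leqnn _) (card_bigcup_le _ _)).
apply: leq_trans (leq_card_setU _ _); apply/subset_leq_card/subsetP => a.
case/colors_inP=> x [y [_ _ nxy <-]].
have cross u v : u \notin S -> v \in S -> u != v ->
    col u v \in colors_in f S :|: \bigcup_(w in ~: S) new_colors w.
  move=> uS vS nuv; rewrite in_setU; have [//|nin] := boolP (_ \in colors_in f S).
  apply/bigcupP; exists u; first by rewrite in_setC.
  by rewrite in_setD nin; apply: imset_f.
have [xS | xS] := boolP (x \in S); have [yS | yS] := boolP (y \in S).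
- by apply/setUP; left; apply/colors_inP; exists x, y.
- by rewrite -/(col x y) colC; apply: cross; rewrite // eq_sym.
- exact: cross.
have := outer x y xS yS nxy; case/setUP=> h; apply/setUP; [by left | right].
by apply/bigcupP; exists x; rewrite // in_setC.
Qed.

Section NoLongerCycle.

Hypothesis no_longer : forall s' : seq V,
  size s' = (2 * d).+2 -> ~~ rainbow_cycle col s'.

(** By [insert_vertex], the new colours of [w] lead to pairwise nonconsecutive
    vertices of the cycle. *)
Lemma card_new_colors w : w \notin S -> #|new_colors w| <= d.
Proof.
move=> wS.
have sN : new_colors w \subset [set col w x | x in S] by apply: subsetDl.
have [R sRS [injR ER]] := exists_reps sN.
rewrite -ER (card_in_imset injR).
have sRs : {subset R <= s} by move=> x /(subsetP sRS)/S_s.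
have := consecutive_in_set Us sRs; rewrite size_s.
suff -> : [set x in R | next s x \in R] = set0 by rewrite cards0; lia.
apply/setP=> x; rewrite !inE; apply/negP=> /andP[xR yR].
have new z : z \in R -> col w z \notin cycle_colors col s.
  move=> zR; apply/negP=> /cycle_colors_sub; apply/negP.
  by have := imset_f (col w) zR; rewrite ER => /setDP[].
have [|||||s' rs' szs'] := @insert_vertex _ _ f s w x rainbow_s.
- by rewrite inE in wS.
- exact: sRs.
- by apply/eqP=> /(injR _ _ xR yR)/eqP; apply/negP/next_neq/sRs.
- exact: new.
- exact: new.
by have := no_longer (s' := s'); rewrite szs' size_s rs' => /(_ erefl).
Qed.

(** At most [d (2 d + 1)] colours occur on the cycle, and each of the other
    vertices adds at most [d]: at most [d n] in all.  With [d n] colours, all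
    edges inside [S] have different colours; any two vertices [x], [y] of [S]
    are then consecutive on a rainbow cycle, and a vertex off [S] cannot have
    two new colours. *)
Lemma card_colors_rainbow_cycle :
    (forall u v, u \notin S -> v \notin S -> u != v -> col u v \in cycle_colors col s) ->
    (2 * d).+1 < #|V| ->
  #|colors_in f setT| < d * #|V|.
Proof.
move=> outer lt_V; rewrite ltnNge; apply/negP => many.
have := card_colors_around; have := many => /[swap] around.
have {around} : #|colors_in f setT| <= #|colors_in f S| + \sum_(w in ~: S) #|new_colors w|.
  by apply: around => u v uS vS nuv; rewrite in_setU cycle_colors_sub ?outer.
move=> around.
have card_CS : #|~: S| = #|V| - (2 * d).+1 by rewrite cardsCs setCK card_S.
have bin_d := bin2_odd d.
have inj_f : {in pairs S &, injective f}.
  apply/imset_injP; rewrite eqn_leq leq_imset_card /= card_pairs card_S bin_d.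
  have le_sum : \sum_(w in ~: S) #|new_colors w| <= \sum_(w in ~: S) d.
    by apply: leq_sum => w; rewrite in_setC => /card_new_colors.
  move: le_sum; rewrite sum_nat_const card_CS => le_sum.
  have := leq_trans many (leq_trans around (leq_add (leqnn _) le_sum)).
  rewrite -/(colors_in f S); move: lt_V; clear.
  by move: #|V| #|colors_in f S|; nia.
have le1 w : w \in ~: S -> #|new_colors w| <= 1.
  rewrite in_setC => wS; rewrite leqNgt; apply/negP => /card_gt1P[a [b [aN bN nab]]].
  case/setDP: aN => /imsetP[x xS Ea] aS; case/setDP: bN => /imsetP[y yS Eb] bS.
  have nxy : x != y by apply: contraNneq nab => E; rewrite Ea Eb E.
  pose s' := x :: y :: enum (S :\: [set x; y]).
  have mem_s' : s' =i S.
    move=> z; rewrite !in_cons mem_enum in_setD !inE negb_or.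
    have [->|_] := eqVneq z x; first by have := xS; rewrite inE.
    by have [->|_] := eqVneq z y; first by have := yS; rewrite inE.
  have Us' : uniq s'.
    by rewrite /= inE negb_or nxy !mem_enum !inE !eqxx ?orbT enum_uniq.
  have sz_s' : size s' = (2 * d).+1.
    by rewrite -(card_uniqP Us') (eq_card mem_s').
  have gt2_s' : 2 < size s' by rewrite sz_s' -size_s.
  have pair_next z : z \in s' -> [set z; next s' z] \in pairs S.
    move=> zs; rewrite mem_pairs -!mem_s' mem_next zs !andTb.
    by apply/eqP=> E; have := next_next_neq Us' gt2_s' zs; rewrite -!E eqxx.
  have rs' : rainbow_cycle col s'.
    apply/rainbow_cycleP; split=> // z t zs ts E.
    apply: (cycle_edge_inj Us' gt2_s') => //.
    by apply: inj_f E; apply: pair_next.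
  have c_s' : {subset cycle_colors col s' <= colors_in f S}.
    move=> c; rewrite cycle_colorsE // => /mapP[z zs ->].
    by apply: imset_f; apply: pair_next.
  have nx : next s' x = y by rewrite /= eqxx.
  have [|||||s2 rs2 sz2] := @insert_vertex _ _ f s' w x rs'.
  - by rewrite mem_s'.
  - by rewrite mem_s'.
  - by rewrite nx -/(col w x) -/(col w y) -Ea -Eb.
  - by apply: contra aS => /c_s'; rewrite Ea.
  - by rewrite nx; apply: contra bS => /c_s'; rewrite Eb.
  by have := no_longer (s' := s2); rewrite sz2 sz_s' rs2 => /(_ erefl).
have le_sum : \sum_(w in ~: S) #|new_colors w| <= \sum_(w in ~: S) 1 by apply: leq_sum.
move: le_sum; rewrite sum_nat_const muln1 card_CS => le_sum.
have := leq_trans many (leq_trans around (leq_add (card_colors_in f S) le_sum)).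
rewrite card_S bin_d; move: lt_V d_ge2; clear.
by move: #|V| => n; nia.
Qed.

End NoLongerCycle.

Section MonochromaticCliques.

Definition monochromatic (Q : {set V}) (a : C) : Prop :=
  forall x y, x \in Q -> y \in Q -> x != y -> col x y = a.

Hypothesis mono_clique : forall X : {set V}, #|X| = (2 * d).+2 ->
  exists (Q : {set V}) (a : C), [/\ Q \subset X, #|Q| = d.+2 & monochromatic Q a].

Lemma monochromaticS (A B : {set V}) a :
  A \subset B -> monochromatic B a -> monochromatic A a.
Proof. by move=> /subsetP sAB mB x y /sAB xB /sAB yB; apply: mB. Qed.

Lemma card_mono_meet (A B : {set V}) a b :
  monochromatic A a -> monochromatic B b -> a != b -> #|A :&: B| <= 1.
Proof.
move=> mA mB; apply: contraNT; rewrite -ltnNge => /card_gt1P[x [y [xAB yAB nxy]]].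
case/setIP: xAB => xA xB; case/setIP: yAB => yA yB.
by rewrite -(mA x y) // -(mB x y).
Qed.

Let next_col_inj x y : x \in s -> y \in s ->
  col x (next s x) = col y (next s y) -> x = y.
Proof. by have /rainbow_cycleP[_] := rainbow_s; apply. Qed.

(** [d + 1] vertices of the cycle span an edge of it, and [d + 2] would span at
    least three, while a rainbow cycle has at most one edge of each colour. *)
Lemma edge_in_mono (I : {set V}) a : I \subset S -> monochromatic I a -> d < #|I| ->
  #|I| = d.+1 /\ exists x, [/\ x \in I, next s x \in I & a = col x (next s x)].
Proof.
move=> /subsetP sIS mI lt_d.
have sIs : {subset I <= s} by move=> x /sIS/S_s.
have := consecutive_in_set Us sIs; rewrite size_s.
set T := [set x in I | _].
have le1 : #|T| <= 1.
  rewrite leqNgt; apply/negP=> /card_gt1P[x [y []]]; rewrite !inE.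
  move=> /andP[xI nxI] /andP[yI nyI] /eqP[]; apply: next_col_inj; try exact: sIs.
  by rewrite !mI ?next_neq ?sIs.
move=> le_I; split; first by move: le1 lt_d le_I; clear; lia.
have /card_gt0P[x] : 0 < #|T| by move: lt_d le_I; clear; lia.
rewrite inE => /andP[xI nxI]; exists x; split=> //.
by rewrite mI ?next_neq ?sIs.
Qed.

(** The clique found in the cycle together with [w]: it is [w |: I], in the
    colour of the edge of the cycle that starts at [x]. *)
Definition star w (I : {set V}) x : Prop :=
  [/\ I \subset S, #|I| = d.+1, x \in I, next s x \in I
    & monochromatic (w |: I) (col x (next s x))].

Lemma star_of_clique w (Q : {set V}) a : w \notin S -> Q \subset w |: S ->
  #|Q| = d.+2 -> monochromatic Q a -> exists x, star w (Q :&: S) x.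
Proof.
move=> wS sQ cQ mQ; have sub := subsetIl Q S.
have cQS : #|Q| <= #|Q :&: S| + (w \in Q).
  have -> : Q :&: S = Q :\ w.
    apply/setP=> z; rewrite in_setI in_setD1 andbC.
    case zQ: (z \in Q); rewrite ?andbF // !andbT.
    have := subsetP sQ z zQ; rewrite in_setU1; case: eqVneq => [-> _|//].
    exact: negbTE.
  by rewrite [leqLHS](cardsD1 w) addnC.
have lt_d : d < #|Q :&: S| by have := leq_b1 (w \in Q); rewrite cQ in cQS; lia.
have [cI [x [xI nxI Ea]]] := edge_in_mono (subsetIr _ _) (monochromaticS sub mQ) lt_d.
have wQ : w \in Q by move: cQS; rewrite cQ cI; case: (w \in Q); rewrite ?addn0 ?ltnn.
exists x; split=> //; first exact: subsetIr.
by rewrite -Ea; apply: monochromaticS mQ; rewrite subUset sub1set wQ.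
Qed.

Lemma star_exists w : w \notin S -> exists I x, star w I x.
Proof.
move=> wS; have [|Q [a [sQ cQ mQ]]] := @mono_clique (w |: S).
  by rewrite cardsU1 wS card_S.
have [x st] := star_of_clique wS sQ cQ mQ.
by exists (Q :&: S), x.
Qed.

Lemma subsets_meet (I J : {set V}) : I \subset S -> J \subset S ->
  (2 * d).+1 < #|I| + #|J| -> exists2 t, t \in I & t \in J.
Proof.
move=> sI sJ lt; have /card_gt0P[t /setIP[tI tJ]] : 0 < #|I :&: J|; last by exists t.
have := subset_leq_card (_ : I :|: J \subset S); rewrite subUset sI sJ card_S => /(_ isT).
by have := cardsUI I J; move: lt; clear; lia.
Qed.

Lemma star_col w I x t : w \notin S -> star w I x -> t \in I ->
  col w t = col x (next s x).
Proof.
case=> wS [sI _ _ _ mI] tI; apply: mI; rewrite ?setU11 ?setU1r //.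
by apply: contraNneq wS => ->; apply: (subsetP sI).
Qed.

(** Two sets of [d + 1] vertices of the cycle meet, so both cliques at [w] have
    the colour of an edge from [w] to a common vertex. *)
Lemma star_edge_uniq w I x J y : w \notin S -> star w I x -> star w J y -> x = y.
Proof.
move=> wS stI stJ; have [sI cI xI _ _] := stI; have [sJ cJ yJ _ _] := stJ.
have [t tI tJ] : exists2 t, t \in I & t \in J.
  by apply: subsets_meet; rewrite // cI cJ; clear; lia.
apply: next_col_inj; [exact/S_s/(subsetP sI) | exact/S_s/(subsetP sJ) |].
by rewrite -(star_col wS stI tI) (star_col wS stJ tJ).
Qed.

(** [I] and [J'] have the colour of [u], [J] that of [v], and sets of different
    colours share at most one vertex.  So [I] and [J'] each consist of [S - J]
    and one vertex of [J], and edges inside their union have one of the two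
    colours; but the union has [d + 2] vertices and spans three edges of the
    cycle, of three different colours. *)
Lemma star_conflict u v I x J y z J' x' : u \notin S -> v \notin S ->
  star u I x -> star v J y -> x != y -> z \in I -> z \in J ->
  star u J' x' -> z \notin J' -> False.
Proof.
move=> uS vS stI stJ nxy zI zJ stJ' zJ'.
have Ex := star_edge_uniq uS stI stJ'; rewrite -{x'}Ex in stJ'.
have [sI cI xI _ mI] := stI; have [sJ cJ yJ _ mJ] := stJ; have [sJ' cJ' _ _ mJ'] := stJ'.
have xs : x \in s by exact/S_s/(subsetP sI).
have ys : y \in s by exact/S_s/(subsetP sJ).
have {}mI := monochromaticS (subsetUr _ _) mI.
have {}mJ := monochromaticS (subsetUr _ _) mJ.
have {}mJ' := monochromaticS (subsetUr _ _) mJ'.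
have nab : col x (next s x) != col y (next s y).
  by apply: contraNneq nxy => /next_col_inj->.
have outside (A : {set V}) : A \subset S -> #|A| = d.+1 ->
    monochromatic A (col x (next s x)) -> A :\: J = S :\: J.
  move=> sA cA mA; apply/eqP; rewrite eqEcard setSD //.
  rewrite !cardsD card_S cA (setIidPr sJ) cJ; have := card_mono_meet mA mJ nab.
  by clear; lia.
have two_colors p q : p \in I :|: J' -> q \in I :|: J' -> p != q ->
    (col p q == col x (next s x)) || (col p q == col y (next s y)).
  have side r (A B : {set V}) : A \subset S -> #|A| = d.+1 ->
      monochromatic A (col x (next s x)) -> B \subset S -> #|B| = d.+1 ->
      monochromatic B (col x (next s x)) ->
      r \in A -> r \notin B -> r \in J.
    move=> sA cA mA sB cB mB rA rB; apply: contraNT rB => rJ.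
    have : r \in A :\: J by rewrite in_setD rJ.
    by rewrite (outside A) // -(outside B) // => /setDP[].
  move=> pY qY npq.
  have [/andP[pI qI] | nI] := boolP ((p \in I) && (q \in I)); first by rewrite mI ?eqxx.
  have [/andP[pI qI] | nJ'] := boolP ((p \in J') && (q \in J')); first by rewrite mJ' ?eqxx.
  suff [pJ qJ] : p \in J /\ q \in J by rewrite (mJ p q) ?eqxx ?orbT.
  move: pY qY; rewrite !in_setU; move: nI nJ'; rewrite !negb_and.
  case pI: (p \in I); case qI: (q \in I) => //=;
    case pJ': (p \in J'); case qJ': (q \in J') => //= _ _ _ _.
  - split; first by apply: (side p I J') => //; rewrite pJ'.
    by apply: (side q J' I) => //; rewrite qI.
  - split; first by apply: (side p J' I) => //; rewrite pI.
    by apply: (side q I J') => //; rewrite qJ'.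
have Ys : {subset I :|: J' <= s}.
  by move=> p /setUP[/(subsetP sI) | /(subsetP sJ')] /S_s.
have := consecutive_in_set Us Ys; rewrite size_s.
set T := [set p in _ | _]; have leT : #|T| <= 2.
  apply: leq_trans (_ : #|[set x; y]| <= 2); last by rewrite cards2; case: (x != y).
  apply/subset_leq_card/subsetP => p; rewrite !inE -!in_setU => /andP[pY npY].
  have ps := Ys _ pY; have := two_colors _ _ pY npY (next_neq ps).
  by case/orP=> /eqP/next_col_inj->; rewrite ?eqxx ?orbT.
have : #|z |: J'| <= #|I :|: J'|.
  by apply/subset_leq_card; rewrite setSU // sub1set.
rewrite cardsU1 zJ' cJ'; move: leT; clear; lia.
Qed.

(** Drop a vertex [z] of the cycle: the clique found in the rest together with
    [u] and [v] either contains both, as desired, or is a star of one of them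
    that avoids [z].  The latter is impossible for [z] chosen as the start of
    the edge of the cycle in the stars of [u] and [v], if this edge is the same,
    and as a common vertex of the two stars otherwise ([star_conflict]). *)
Lemma clique_of_edge u v : u \notin S -> v \notin S -> u != v ->
  exists Q : {set V}, [/\ u \in Q, v \in Q, #|Q :&: S| = d &
    monochromatic Q (col u v)].
Proof.
move=> uS vS nuv; apply: contrapT => noQ.
have drop z : z \in S -> (exists J x, star u J x /\ z \notin J) \/
                         (exists J x, star v J x /\ z \notin J).
  move=> zS; pose X := u |: (v |: (S :\ z)).
  have [|Q [a [sQ cQ mQ]]] := @mono_clique X.
    rewrite !cardsU1 !inE negb_or nuv -/S.
    have -> : (u \in s) = false by move: uS; rewrite inE => /negbTE.
    have -> : (v \in s) = false by move: vS; rewrite inE => /negbTE.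
    by have := cardsD1 z S; rewrite zS card_S !andbF add1n => -[<-].
  have zQ w : w \in Q -> [|| w == u, w == v | (w != z) && (w \in S)].
    by move/(subsetP sQ); rewrite !in_setU1 in_setD1.
  have zNQ : z \notin Q :&: S.
    apply/negP=> /setIP[/zQ + _]; rewrite eqxx orbF => /orP[]/eqP Ez.
      by rewrite -Ez zS in uS.
    by rewrite -Ez zS in vS.
  have [uQ | uQ] := boolP (u \in Q); last first.
    right; have sQv : Q \subset v |: S.
      apply/subsetP=> w wQ; rewrite in_setU1; case/or3P: (zQ w wQ) => [/eqP Ew|->//|].
        by rewrite -Ew wQ in uQ.
      by case/andP=> _ ->; rewrite orbT.
    by have [x st] := star_of_clique vS sQv cQ mQ; exists (Q :&: S), x.
  have [vQ | vQ] := boolP (v \in Q); last first.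
    left; have sQu : Q \subset u |: S.
      apply/subsetP=> w wQ; rewrite in_setU1; case/or3P: (zQ w wQ) => [->//|/eqP Ew|].
        by rewrite -Ew wQ in vQ.
      by case/andP=> _ ->; rewrite orbT.
    by have [x st] := star_of_clique uS sQu cQ mQ; exists (Q :&: S), x.
  case: noQ; exists Q; split=> //; last by rewrite (mQ u v).
  have -> : Q :&: S = (Q :\ u) :\ v.
    apply/setP=> w; rewrite in_setI !in_setD1.
    have [-> | nwv] := eqVneq w v; first by rewrite (negPf vS) andbF.
    have [-> | nwu] := eqVneq w u; first by rewrite (negPf uS) andbF.
    rewrite /= andbC; case wQ: (w \in Q); rewrite ?andbF // andbT.
    by have := zQ w wQ; rewrite (negPf nwu) (negPf nwv) => /andP[].
  have := cardsD1 u Q; rewrite uQ cQ; have := cardsD1 v (Q :\ u).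
  by rewrite in_setD1 eq_sym nuv vQ /= !add1n => -> [].
have [I [x stI]] := star_exists uS; have [J [y stJ]] := star_exists vS.
have [sI cI xI _ _] := stI; have [sJ cJ yJ _ _] := stJ.
have [Exy | nxy] := eqVneq x y.
  case: (drop x (subsetP sI x xI)) => -[J' [x' [st']]].
    have Ex := star_edge_uniq uS stI st'; rewrite -{}Ex in st'.
    by case: st' => _ _ ->.
  have Ex := star_edge_uniq vS stJ st'; rewrite -{}Ex -Exy in st'.
  by case: st' => _ _ ->.
have [z zI zJ] : exists2 z, z \in I & z \in J.
  by apply: subsets_meet; rewrite // cI cJ; clear; lia.
case: (drop z (subsetP sI z zI)) => -[J' [x' [st' zJ']]].
  exact: (star_conflict uS vS stI stJ nxy zI zJ st' zJ').
by rewrite eq_sym in nxy; apply: (star_conflict vS uS stJ stI nxy zJ zI st' zJ').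
Qed.

(** The star of [u] makes all edges inside its [d + 1] vertices of the cycle equal
    in colour.  A vertex [w] off the cycle has new colours only towards the [d]
    vertices outside its star; if some edge [ww'] off the cycle has a colour not
    on the cycle, the clique of [clique_of_edge] covers these [d] vertices, so
    the colour of [ww'] is the only new one at [w].  This occurs at [u]. *)
Lemma card_colors_mono_clique u v : u \notin S -> v \notin S -> u != v ->
    col u v \notin cycle_colors col s ->
  #|colors_in f setT| + 'C(d.+1, 2) + d <= d * #|V| + 2.
Proof.
move=> uS vS nuv newuv.
have outer w w' : w \notin S -> w' \notin S -> w != w' ->
    col w w' \notin cycle_colors col s ->
    (exists2 t, t \in S & col w t = col w w') /\ (forall I x t, star w I x -> t \in S ->
       col w t = col x (next s x) \/ col w t = col w w').
  move=> wS w'S nww' new_ww'.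
  have [Q [wQ w'Q cQ mQ]] := clique_of_edge wS w'S nww'.
  have colQ t : t \in Q :&: S -> col w t = col w w'.
    by case/setIP=> tQ tS; apply: mQ => //; apply: contraNneq wS => ->.
  split.
    have /card_gt0P[t tQS] : 0 < #|Q :&: S| by rewrite cQ ltnW.
    by exists t; [case/setIP: tQS | apply: colQ].
  move=> I x t stI tS; have [sI cI xI _ _] := stI.
  have xs : x \in s by exact/S_s/(subsetP sI).
  have disj : I :&: (Q :&: S) = set0.
    apply/setP=> r; rewrite in_set0 in_setI; apply/negP=> /andP[rI rQ].
    case/negP: new_ww'; rewrite -(colQ r rQ) (star_col wS stI rI); exact: next_col.
  have cov : I :|: (Q :&: S) = S.
    apply/eqP; rewrite eqEcard subUset sI subsetIr /= cardsU disj cards0 cI cQ card_S.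
    by clear; lia.
  move: tS; rewrite -cov => /setUP[tI | /colQ]; last by right.
  by left; apply: star_col stI tI.
have around : #|colors_in f setT| <= #|colors_in f S| + \sum_(w in ~: S) #|new_colors w|.
  apply: card_colors_around => w w' wS w'S nww'; rewrite in_setU.
  have [//|nin] := boolP (col w w' \in colors_in f S).
  have new_ww' : col w w' \notin cycle_colors col s.
    by apply: contra nin; apply: cycle_colors_sub.
  have [[t tS Et] _] := outer w w' wS w'S nww' new_ww'.
  by rewrite in_setD nin -Et imset_f.
have le_d w : w \notin S -> #|new_colors w| <= d.
  move=> wS; have [I [x stI]] := star_exists wS; have [sI cI xI _ _] := stI.
  have cSI : #|S :\: I| = d by rewrite cardsD (setIidPr sI) cI card_S; clear; lia.
  rewrite -[X in _ <= X]cSI; apply: leq_trans (leq_imset_card (col w) _).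
  apply/subset_leq_card/subsetP => a /setDP[/imsetP[t tS ->] nin].
  apply: imset_f; rewrite in_setD tS andbT; apply: contra nin => tI.
  rewrite (star_col wS stI tI); apply/cycle_colors_sub/next_col.
  exact/S_s/(subsetP sI).
have [I [x stI]] := star_exists uS; have [sI cI xI nxI mI] := stI.
have xs : x \in s by exact/S_s/(subsetP sI).
have le_1 : #|new_colors u| <= 1.
  rewrite -(cards1 (col u v)); apply/subset_leq_card/subsetP => a.
  case/setDP=> /imsetP[t tS ->] nin; rewrite inE.
  have [_ /(_ I x t stI tS)[Et | ->//]] := outer u v uS vS nuv newuv.
  by case/negP: nin; rewrite Et; apply/cycle_colors_sub/next_col.
have le_S : #|colors_in f S| + 'C(d.+1, 2) <= 'C((2 * d).+1, 2) + 1.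
  have sub : colors_in f S \subset f @: (pairs S :\: pairs I) :|: [set col x (next s x)].
    apply/subsetP=> a /imsetP[A AS ->]; rewrite in_setU.
    have [AI | AI] := boolP (A \in pairs I); last by rewrite imset_f // in_setD AI.
    apply/orP; right; rewrite inE; apply/eqP; move: AI.
    rewrite inE => /andP[+ /cards2P[y [z [nyz EA]]]]; rewrite EA subUset !sub1set.
    by case/andP=> yI zI; apply: mI; rewrite ?setU1r.
  have sPP : pairs I \subset pairs S.
    by apply/subsetP=> A; rewrite !inE => /andP[sA ->]; rewrite (subset_trans sA sI).
  apply: leq_trans (_ : #|pairs S :\: pairs I| + 1 + 'C(d.+1, 2) <= _).
    rewrite leq_add2r; apply: leq_trans (subset_leq_card sub) _.
    by apply: leq_trans (leq_card_setU _ _) _; rewrite cards1 leq_add2r leq_imset_card.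
  have := subset_leq_card sPP.
  rewrite cardsD (setIidPr sPP) !card_pairs cI card_S => le_C.
  by rewrite addnAC subnK.
have bin_d := bin2_odd d.
have le_sum : \sum_(w in ~: S) #|new_colors w| <= 1 + #|(~: S) :\ u| * d.
  rewrite (big_setD1 u) ?in_setC //= leq_add // -sum_nat_const.
  by apply: leq_sum => w; rewrite in_setD1 in_setC => /andP[_ /le_d].
have := cardsC S; have := cardsD1 u (~: S); rewrite in_setC uS card_S /= add1n.
move: around le_sum le_S; rewrite bin_d; move: d_ge2; clear.
move: #|V| #|_ :\ u| #|~: S| #|colors_in f S| #|colors_in f setT| (\sum_(w in _) _) 'C(_, 2).
by move=> n m k c1 c2 sum b; nia.
Qed.

End MonochromaticCliques.
End AroundCycle.

(** * Copies of graphs and rainbow cycles *)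

Lemma copy_edgesP n (G : sgraph) (f : G -> 'I_n) e :
  reflect (exists a b : G, adj a b /\ e = [set f a; f b]) (e \in copy_edges f).
Proof.
apply: (iffP imsetP) => [[A] | [a [b [Gab ->]]]].
  case/imsetP=> -[a b]; rewrite inE /= => Gab -> ->.
  by exists a, b; rewrite imsetU1 imset_set1.
exists [set a; b]; last by rewrite imsetU1 imset_set1.
by apply/imsetP; exists (a, b); rewrite ?inE.
Qed.

Lemma edges_complete n : edges (complete n) = pairs [set: 'I_n].
Proof.
apply/setP=> e; apply/imsetP/idP => [[[x y]]|].
  by rewrite inE /= => nxy ->; rewrite mem_pairs !inE.
rewrite inE subsetT => /cards2P[x [y [nxy ->]]].
by exists (x, y); rewrite ?inE.
Qed.

Lemma next_enum_ord k (i : 'I_k) : next (enum 'I_k) i = ordS i.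
Proof.
case: k i => [[]//|k] i; rewrite next_nth mem_enum /= enum_ordSl.
rewrite -enum_ordSl index_enum_ord.
have [lt_ik | le_ki] := ltnP i k.
  rewrite (nth_map (Ordinal lt_ik)) ?size_enum_ord //; apply: val_inj.
  by rewrite /= nth_enum_ord // modn_small.
rewrite nth_default; last by rewrite size_map size_enum_ord.
apply: val_inj => /=; have -> : i = k :> nat.
  by apply/eqP; rewrite eqn_leq le_ki -ltnS ltn_ord.
by rewrite modnn.
Qed.

Section ColoringOfComplete.

Variables (n : nat) (c : coloring n).

Let N := \max_(e : {set 'I_n}) c e.

(** The truncation to a finite type of colours loses nothing, as [N] bounds all
    the values of [c]. *)
Definition finite_coloring (e : {set 'I_n}) : 'I_N.+1 := inord (c e).
Local Notation fc := finite_coloring.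
Let col (x y : 'I_n) := fc [set x; y].

Lemma finite_coloring_inj e e' : fc e = fc e' -> c e = c e'.
Proof.
have lt_N A : c A < N.+1 by rewrite ltnS; apply: (leq_bigmax A).
by move/(congr1 val); rewrite /= !inordK.
Qed.

Lemma finite_coloringE e e' : (fc e == fc e') = (c e == c e').
Proof.
by apply/eqP/eqP => [/finite_coloring_inj // | E]; rewrite /fc E.
Qed.

Lemma num_colors_le_colors_in : num_colors c <= #|colors_in fc setT|.
Proof.
rewrite /num_colors edges_complete cardE; set l := undup _.
have lt_N e : c e < N.+1 by rewrite ltnS; apply: (leq_bigmax e).
have l_c a : a \in l -> exists2 e, e \in pairs setT & a = c e.
  by rewrite mem_undup => /imageP[e eT ->]; exists e.
rewrite -(size_map (@inord N) l); apply: uniq_leq_size.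
  rewrite map_inj_in_uniq ?undup_uniq // => a b /l_c[e _ ->] /l_c[e' _ ->].
  exact: finite_coloring_inj.
move=> a /mapP[b /l_c[e eT ->] ->]; rewrite mem_enum; exact: imset_f.
Qed.

Section CycleCopies.

Variables (k : nat) (h : 'I_k -> 'I_n).
Hypothesis k_gt2 : 2 < k.
Hypothesis h_inj : injective h.

Let s := [seq h i | i <- enum 'I_k].

Let size_s : size s = k. Proof. by rewrite size_map size_enum_ord. Qed.

Let Us : uniq s. Proof. by rewrite map_inj_uniq ?enum_uniq. Qed.

Let next_h i : next s (h i) = h (ordS i).
Proof. by rewrite next_map ?enum_uniq // next_enum_ord. Qed.

Let mem_h i : h i \in s. Proof. by apply: map_f; rewrite mem_enum. Qed.

Let memP x : x \in s -> exists i, x = h i.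
Proof. by case/mapP=> i _ ->; exists i. Qed.

Lemma cycle_copy_edge (e : {set 'I_n}) : e \in copy_edges (G := cycle_graph k) h ->
  exists i, e = [set h i; next s (h i)].
Proof.
case/copy_edgesP=> a [b [/andP[_ /orP[]/eqP E] ->]].
  by exists a; rewrite next_h E.
by exists b; rewrite next_h E setUC.
Qed.

Lemma copy_cycle_edge x : x \in s ->
  [set x; next s x] \in copy_edges (G := cycle_graph k) h.
Proof.
case/memP=> i ->; apply/copy_edgesP; exists i, (ordS i); split; last by rewrite next_h.
rewrite /adj /= /cycle_adj eqxx andbT; apply/eqP=> E.
have := next_next_neq Us _ (mem_h i); rewrite size_s => /(_ k_gt2).
by rewrite !next_h -!E eqxx.
Qed.

Lemma rainbow_copy_cycle :
  {in copy_edges (G := cycle_graph k) h &, injective c} <-> rainbow_cycle col s.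
Proof.
split=> [inj | /rainbow_cycleP[_ inj] e e'].
  apply/rainbow_cycleP; split=> // x y xs ys /finite_coloring_inj/inj E.
  have gt2 : 2 < size s by rewrite size_s.
  by apply: (cycle_edge_inj Us gt2 xs ys); apply: E; apply: copy_cycle_edge.
move=> /cycle_copy_edge[i ->] /cycle_copy_edge[j ->] /eqP.
rewrite -finite_coloringE => /eqP/inj E.
by rewrite (E (mem_h i) (mem_h j)).
Qed.

End CycleCopies.

Lemma seq_codom (s : seq 'I_n) : uniq s ->
  exists2 h : 'I_(size s) -> 'I_n, injective h & s = [seq h i | i <- enum 'I_(size s)].
Proof.
move=> Us; exists (tnth (in_tuple s)); first exact/tuple_uniqP.
by rewrite map_tnth_enum.
Qed.

Lemma rainbow_cycle_copy s k : rainbow_cycle col s -> size s = k -> 2 < k ->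
  has_rainbow_copy c (cycle_graph k).
Proof.
move=> rs <- gt2; have [Us _] := andP rs; have [h h_inj Es] := seq_codom Us.
exists h => //; apply/rainbow_copy_cycle => //; by rewrite -Es.
Qed.

Lemma copy_rainbow_cycle k : 2 < k -> has_rainbow_copy c (cycle_graph k) ->
  exists2 s, rainbow_cycle col s & size s = k.
Proof.
move=> gt2 [h h_inj inj]; exists [seq h i | i <- enum 'I_k].
  exact/rainbow_copy_cycle.
by rewrite size_map size_enum_ord.
Qed.

Lemma rainbow_cycle_edge_copy s k u v :
    rainbow_cycle col s -> size s = k -> 2 < k ->
    u \notin s -> v \notin s -> u != v -> col u v \notin cycle_colors col s ->
  has_rainbow_copy c (disjoint_union (cycle_graph k) (complete 2)).
Proof.
move=> rs <- gt2 us vs nuv newuv; have [Us _] := andP rs.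
have [h h_inj Es] := seq_codom Us.
have hs i : h i \in s by rewrite Es; apply: map_f; rewrite mem_enum.
pose H (z : disjoint_union (cycle_graph (size s)) (complete 2)) : 'I_n :=
  match z with inl i => h i | inr j => if j == ord0 then u else v end.
have two (j j' : 'I_2) : j != j' -> [set H (inr j); H (inr j')] = [set u; v].
  by case: j j' => [[|[|//]] ?] [[|[|//]] ?] //= _; rewrite setUC.
exists H.
  case=> [i|j] [i'|j'] /=; first by move/h_inj->.
  - by case: ifP => _ E; [case/negP: us | case/negP: vs]; rewrite -E.
  - by case: ifP => _ E; [case/negP: us | case/negP: vs]; rewrite E.
  move=> E; congr inr; apply/eqP/negPn/negP => njj'.
  have := two j j' njj'; rewrite /= E => /setP Euv.
  have := Euv u; have := Euv v; rewrite !inE !eqxx orbT !orbb => /eqP<- /eqP E'.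
  by rewrite E' eqxx in nuv.
have inj : {in copy_edges (G := cycle_graph (size s)) h &, injective c}.
  by apply/rainbow_copy_cycle => //; rewrite -Es.
have split_edge e : e \in copy_edges H ->
    e \in copy_edges (G := cycle_graph (size s)) h \/ e = [set u; v].
  case/copy_edgesP=> [[i|j] [[i'|j'] [//= adj_ij ->]]]; last by right; apply: two.
  by left; apply/copy_edgesP; exists i, i'.
have differ e : e \in copy_edges (G := cycle_graph (size s)) h -> c e <> c [set u; v].
  case/(cycle_copy_edge h_inj) => i -> /eqP; rewrite -finite_coloringE => /eqP E.
  case/negP: newuv; rewrite /col -E -Es cycle_colorsE //.
  by apply/mapP; exists (h i).
move=> e e' /split_edge[he | ->] /split_edge[he' | ->] // E.
- exact: inj.
- by case: (differ e he).
- by case: (differ e' he').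
Qed.

Lemma copy_rainbow_cycle_edge k : 2 < k ->
    has_rainbow_copy c (disjoint_union (cycle_graph k) (complete 2)) ->
  exists s u v, [/\ rainbow_cycle col s, size s = k,
    u \notin s /\ v \notin s, u != v & col u v \notin cycle_colors col s].
Proof.
move=> gt2 [H H_inj inj]; pose h (i : 'I_k) := H (inl i).
have h_inj : injective h by move=> i j /H_inj[].
have sub : {subset copy_edges (G := cycle_graph k) h <= copy_edges H}.
  move=> e /copy_edgesP[a [b [adj_ab ->]]]; apply/copy_edgesP.
  by exists (inl a), (inl b).
have rs : rainbow_cycle col [seq h i | i <- enum 'I_k].
  by apply/rainbow_copy_cycle => // e e' /sub he /sub; apply: inj.
have [Us _] := andP rs.
pose u := H (inr ord0); pose v := H (inr ord_max).
have out j : H (inr j) \notin [seq h i | i <- enum 'I_k].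
  by apply/negP=> /mapP[i _ /H_inj].
have uv_edge : [set u; v] \in copy_edges H.
  by apply/copy_edgesP; exists (inr ord0), (inr ord_max).
exists [seq h i | i <- enum 'I_k], u, v; split=> //.
- by rewrite size_map size_enum_ord.
- by split; apply: out.
- by apply/eqP=> /H_inj.
rewrite cycle_colorsE //; apply/negP=> /mapP[x xs /finite_coloring_inj E].
have xe := sub _ (copy_cycle_edge gt2 h_inj xs).
have /setP/(_ u) := inj _ _ uv_edge xe E; rewrite !inE eqxx /=.
have us := out ord0; rewrite -/u in us.
by case: eqP => [Eu | _ /esym/eqP Eu]; case/negP: us; rewrite Eu // mem_next.
Qed.

Lemma mono_clique_of_class p q (X : {set 'I_n}) : 1 < q ->
    (forall f : complete p -> 'I_n, injective f ->
      has_class_in (containing (complete q)) c f) ->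
    #|X| = p ->
  exists (Q : {set 'I_n}) (a : 'I_N.+1), [/\ Q \subset X, #|Q| = q & monochromatic fc Q a].
Proof.
move=> gt1 class cX; pose f (i : complete p) : 'I_n := enum_val (cast_ord (esym cX) i).
have f_inj : injective f by move=> i j /enum_val_inj/cast_ord_inj.
have [a _ [G [g g_inj g_adj] [h /bij_inj h_inj h_adj]]] := class f f_inj.
pose r (i : 'I_q) : 'I_n := val (h (g i)).
have r_inj : injective r by move=> i j /val_inj/h_inj/g_inj.
have r_edge i j : i != j -> [set r i; r j] \in copy_edges f /\ c [set r i; r j] = a.
  move=> nij; have : adj (h (g i)) (h (g j)) by rewrite h_adj g_adj.
  by case/andP=> _; rewrite inE => /andP[? /eqP].
exists [set r i | i : 'I_q], (inord a); split.
- apply/subsetP=> x /imsetP[i _ ->].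
  have [j nij] : exists j, i != j.
    pose i0 := Ordinal (ltnW gt1); pose i1 := Ordinal gt1.
    by have [->|ni] := eqVneq i i0; [exists i1 | exists i0].
  have [/copy_edgesP[y [z [_ Er]]] _] := r_edge i j nij.
  move/setP/(_ (r i)): Er; rewrite !inE eqxx /= => /esym/orP[]/eqP->; exact: enum_valP.
- by rewrite card_imset // card_ord.
move=> x y /imsetP[i _ ->] /imsetP[j _ ->] nxy.
have nij : i != j by apply: contraNneq nxy => ->.
by have [_ E] := r_edge i j nij; rewrite /finite_coloring E.
Qed.

End ColoringOfComplete.

(** * The colouring for the lower bound *)

Lemma bin2D m d : 'C(m + d, 2) = 'C(m, 2) + 'C(d, 2) + m * d.
Proof.
elim: d => [|d IHd]; first by rewrite addn0 muln0 !addn0.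
by rewrite addnS !binS IHd !bin1; lia.
Qed.

Lemma bin2_square d : 'C(d, 2) + 'C(d.+1, 2) = d * d.
Proof. by elim: d => // d IHd; have := binS d 1; have := binS d.+1 1; rewrite !bin1; nia. Qed.

Section LowerBound.

Variables n d : nat.
Hypothesis n_ge : d.+2 <= n.

Let S : {set 'I_n} := [set i : 'I_n | i < d].

Let card_S : #|S| = d.
Proof.
have le_dn : d <= n by lia.
have -> : S = [set widen_ord le_dn i | i : 'I_d].
  apply/setP=> i; rewrite inE; apply/idP/imsetP => [lt_id | [j _ ->]]; last exact: (ltn_ord j).
  by exists (Ordinal lt_id) => //; apply: val_inj.
by rewrite card_imset ?card_ord // => i j /(congr1 val) E; apply: val_inj.
Qed.

Definition hub_coloring : coloring n :=
  fun e => if e \subset ~: S then 0 else (enum_rank e).+1.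

Lemma num_colors_hub : d * n + 1 <= num_colors hub_coloring + 'C(d.+1, 2).
Proof.
pose E := pairs [set: 'I_n] :\: pairs (~: S).
have card_CS : #|~: S| = n - d by rewrite cardsCs setCK card_S card_ord.
have card_E : #|E| + 'C(n - d, 2) = 'C(n, 2).
  have sub : pairs (~: S) \subset pairs [set: 'I_n].
    by apply/subsetP=> e; rewrite !inE subsetT => /andP[_ ->].
  have := subset_leq_card sub.
  by rewrite cardsD (setIidPr sub) !card_pairs card_CS cardsT card_ord => /subnK.
suff le_E : #|E|.+1 <= num_colors hub_coloring.
  apply: leq_trans (_ : #|E|.+1 + 'C(d.+1, 2) <= _); last by rewrite leq_add2r.
  have [m En] : exists m, n = m + d by exists (n - d); lia.
  have {}card_E : #|E| = 'C(d, 2) + m * d.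
    have Em : n - d = m by rewrite En addnK.
    by move: card_E; rewrite Em [in 'C(n, 2)]En bin2D -addnA addnC => /addnI.
  have := bin2_square d; rewrite card_E [in d * n]En; clear; nia.
rewrite /num_colors edges_complete.
have -> : #|E|.+1 = size (0 :: [seq hub_coloring e | e in E]).
  by rewrite /= size_map -cardE.
have hubE e : e \in E -> hub_coloring e = (enum_rank e).+1.
  rewrite !inE subsetT /= => /andP[+ e2]; rewrite e2 andbT.
  by rewrite /hub_coloring => /negPf->.
apply: uniq_leq_size.
  rewrite /= map_inj_in_uniq ?enum_uniq ?andbT.
    by apply/imageP=> -[e eE]; rewrite hubE.
  by move=> e e'; rewrite !mem_enum => eE e'E; rewrite !hubE // => -[/val_inj/enum_rank_inj].
move=> a; rewrite mem_undup inE => /predU1P[-> | /imageP[e eE ->]]; last first.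
  by apply: image_f; case/setDP: eE.
have /card_gt1P[x [y [xS yS nxy]]] : 1 < #|~: S| by rewrite card_CS; lia.
apply/imageP; exists [set x; y]; first by rewrite mem_pairs !inE.
by rewrite /hub_coloring subUset !sub1set xS yS.
Qed.

(** At most [d] of the [p] vertices lie in [S], and the edges among the others all
    have colour [0]. *)
Lemma hub_coloring_class p q (f : complete p -> 'I_n) : 1 < q -> q + d <= p ->
  injective f -> has_class_in (containing (complete q)) hub_coloring f.
Proof.
move=> q_gt1 le_p f_inj; pose Z := [set i : 'I_p | f i \notin S].
have le_qZ : q <= #|Z|.
  have : #|~: Z| <= d.
    rewrite -card_S -(card_imset _ f_inj); apply/subset_leq_card/subsetP => x.
    by case/imsetP=> i; rewrite !inE negbK => fi ->.
  by have := cardsC Z; rewrite card_ord; lia.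
pose r (i : 'I_q) : 'I_p := enum_val (widen_ord le_qZ i).
have r_inj : injective r.
  by move=> i j /enum_val_inj/(congr1 val) E; apply: val_inj.
have rZ i : f (r i) \notin S.
  have : r i \in Z by apply: enum_valP.
  by rewrite inE.
have edge i j : i != j ->
    [set f (r i); f (r j)] \in [set e in copy_edges f | hub_coloring e == 0].
  move=> nij; rewrite inE; apply/andP; split.
    apply/copy_edgesP; exists (r i), (r j); split=> //.
    by rewrite /adj /= /complete_adj inj_eq.
  by rewrite /hub_coloring subUset !sub1set !in_setC !rZ.
pose i0 : 'I_q := Ordinal (ltnW q_gt1); pose i1 : 'I_q := Ordinal q_gt1.
have other i : exists j : 'I_q, i != j.
  by have [->|ni] := eqVneq i i0; [exists i1 | exists i0].
exists 0.
  have := edge i0 i1 isT; rewrite inE => /andP[e01 /eqP E].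
  by apply/imageP; exists [set f (r i0); f (r i1)].
exists (color_class hub_coloring f 0); last by exists id; [exists id | ].
have cov i : f (r i) \in cover [set e in copy_edges f | hub_coloring e == 0].
  have [j nij] := other i; apply/bigcupP; exists [set f (r i); f (r j)]; first exact: edge.
  by rewrite !inE eqxx.
exists (fun i : 'I_q => exist _ (f (r i)) (cov i) : color_class hub_coloring f 0).
  by move=> i j /(congr1 val)/f_inj/r_inj.
move=> i j nij; have {}nij : i != j := nij.
by rewrite /adj /= /edge_graph_adj -val_eqE /= (inj_eq f_inj) (inj_eq r_inj) nij edge.
Qed.

End LowerBound.

(** * The theorem *)

Theorem theorem9p28 (q p : nat) (hq : 4 <= q) (hp : p = 2 * q - 2) :
  exists n0 : nat, forall n : nat, n0 < n ->
    let H := family2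
      (disjoint_union (cycle_graph (2 * p - 2 * q + 1)) (complete 2))
      (cycle_graph (2 * p - 2 * q + 2)) in
    [/\ (((p - q) * n)%:Z - 'C(p - q + 1, 2)%:Z + 1
          <= (g n (complete p) (containing (complete q)))%:Z)%R,
        g n (complete p) (containing (complete q)) <= Ar n H
      & Ar n H <= (p - q) * n].
Proof.
have [d Eq d_ge2] : exists2 d, q = d.+2 & 1 < d by exists (q - 2); lia.
have Ep : p = (2 * d).+2 by lia.
exists p => n lt_n.
have -> : 2 * p - 2 * q + 1 = (2 * d).+1 by lia.
have -> : 2 * p - 2 * q + 2 = (2 * d).+2 by lia.
have -> : p - q = d by lia.
have -> : d + 1 = d.+1 by rewrite addn1.
have q_gt1 : 1 < q by lia.
have cycle_gt2 : 2 < (2 * d).+1 by lia.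
move=> H.
have le_n : d.+2 <= n by lia.
have adm : g_admissible n (complete p) (containing (complete q))
    (num_colors (@hub_coloring n d)).
  by exists (@hub_coloring n d) => // f; apply: hub_coloring_class => //; lia.
have lower : d * n + 1 <= g n (complete p) (containing (complete q)) + 'C(d.+1, 2).
  by apply: leq_trans (num_colors_hub le_n) _; rewrite leq_add2r; apply: g_ge.
split.
- by move: lower; lia.
- rewrite /Ar; case: ex_minnP => m /asboolP forced _.
  rewrite leqNgt; apply/negP=> lt_m.
  have [c Ec class] := g_attained (ex_intro _ _ adm).
  have [G HG rainbow] : exists2 G, H G & has_rainbow_copy c G.
    by apply: forced; rewrite Ec ltnW.
  have mono (X : {set 'I_n}) : #|X| = (2 * d).+2 -> exists (Q : {set 'I_n}) a,
      [/\ Q \subset X, #|Q| = d.+2 & monochromatic (finite_coloring c) Q a].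
    by rewrite -Ep -Eq; apply: mono_clique_of_class.
  case: HG => EG; subst G.
    have [s [u [v [rs sz [us vs] nuv newuv]]]] := copy_rainbow_cycle_edge cycle_gt2 rainbow.
    have inS x : x \notin s -> x \notin [set z in s] by rewrite inE.
    have := card_colors_mono_clique d_ge2 rs sz mono (inS _ us) (inS _ vs) nuv newuv.
    have := num_colors_le_colors_in c; rewrite Ec card_ord => le_c le_f.
    by move: lower le_c le_f d_ge2; clear; move: #|_|; lia.
  have [|s rs sz] := copy_rainbow_cycle _ rainbow; first by lia.
  have [Us inj] := rainbow_cycleP _ _ rs.
  have [|Q [a [sQ cQ mQ]]] := mono [set z in s].
    by rewrite cardsE -sz; apply/card_uniqP.
  have Qs : {subset Q <= s} by move=> x /(subsetP sQ); rewrite inE.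
  have := consecutive_in_set Us Qs; rewrite sz cQ => le_T.
  have /card_gt1P[x [y []]] : 1 < #|[set x in Q | next s x \in Q]|.
    by rewrite -(leq_add2r (2 * d).+2); apply: leq_trans le_T; clear; lia.
  rewrite !inE => /andP[xQ nxQ] /andP[yQ nyQ] /eqP[]; apply: inj; try exact: Qs.
  have neq z : z \in s -> z != next s z.
    move=> zs; apply/eqP=> E; have := next_next_neq Us _ zs.
    by rewrite -!E eqxx sz; move=> /(_ _)/negP[] //; lia.
  by rewrite [LHS]mQ ?neq ?Qs // [RHS]mQ ?neq ?Qs.
rewrite /Ar; case: ex_minnP => m _; apply; apply/asboolP => c le_c.
apply: contrapT => none.
have no_longer s : size s = (2 * d).+2 ->
    ~~ rainbow_cycle (fun x y => finite_coloring c [set x; y]) s.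
  move=> sz; apply/negP => rs; apply: none; exists (cycle_graph (2 * d).+2); first by right.
  by apply: rainbow_cycle_copy rs sz _; lia.
have := leq_trans le_c (num_colors_le_colors_in c); apply/negP; rewrite -ltnNge.
have [[s rs sz] | noC] := pselect (exists2 s,
    rainbow_cycle (fun x y => finite_coloring c [set x; y]) s & size s = (2 * d).+1).
  have few := card_colors_rainbow_cycle d_ge2 rs sz no_longer; rewrite card_ord in few.
  apply: few; last by apply: ltnW; rewrite -Ep.
  move=> u v; rewrite !inE => us vs nuv; apply/negPn/negP => newuv; apply: none.
  exists (disjoint_union (cycle_graph (2 * d).+1) (complete 2)); first by left.
  exact: rainbow_cycle_edge_copy rs sz cycle_gt2 us vs nuv newuv.
apply: leq_ltn_trans (card_colors_no_rainbow_cycle d_ge2 _ _) _.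
- by rewrite card_ord; lia.
- move=> s [sz | /no_longer //]; apply/negP => rs; apply: noC.
  by exists s.
by rewrite card_ord ltn_pmul2l; lia.
Qed.
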